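(* Let $G$ be a countable group generated by a finite symmetric set $S$, and let $H$ be a uniformly recurrent subgroup of $G$. Then $H$ is amenable if and only if $\rho(G)=\rho(H\backslash G)$.
   Context: For a $d$-regular countable undirected graph $\mathcal G$ (loops and multiple edges allowed, neighbours counted with multiplicity), $\rho(\mathcal G)$ denotes the spectral radius: the operator norm of the Markov averaging operator $P:\ell^2(\mathcal G)\to\ell^2(\mathcal G)$, $Pf(v)=\frac1{\deg v}\sum_{v'\sim v}f(v')$. For a group $G$ with finite symmetric generating set $S$ and a subgroup $H\le G$, $\rho(G)$ is the spectral radius of the Cayley graph of $(G,S)$, and $\rho(H\backslash G)$ is the spectral radius of the Schreier graph on the coset space $H\backslash G=\{Hg: g\in G\}$, in which $Hg$ is joined to $Hgs$ for each $s\in S$ (with multiplicity). So $\rho(H\backslash G)$ is the norm on $\ell^2(H\backslash G)$ of $f\mapsto \big(Hg\mapsto\frac1{|S|}\sum_{s\in S}f(Hgs)\big)$. $\mathrm{Sub}_G$ is the set of all subgroups of $G$ with the Chabauty topology (for countable discrete $G$, the topology induced from the product topology on $\{0,1\}^G$), on which $G$ acts by conjugation. A subgroup $H\le G$ is called a uniformly recurrent subgroup (URS) if the closure $X$ of the conjugacy class of $H$ in $\mathrm{Sub}_G$ is a minimal $G$-system, i.e. every $G$-orbit in $X$ is dense in $X$. *)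

(* Defs.v *)
From HB Require Import structures.
From mathcomp Require Import all_boot all_order all_algebra finmap.
From mathcomp Require Import all_classical all_reals all_analysis.

Set Implicit Arguments.
Unset Strict Implicit.
Unset Printing Implicit Defensive.

Import Order.TTheory GRing.Theory Num.Theory.
Import numFieldNormedType.Exports.

Local Open Scope classical_set_scope.
Local Open Scope ring_scope.

(* A graph is given by its neighbour lists; the multiplicity of w in [nbr v]
   is the number of edges from v to w. *)

Definition markov (R : realType) (V : Type) (nbr : V -> seq V) (f : V -> R) :
    V -> R :=
  fun v => (size (nbr v))%:R^-1 * \sum_(w <- nbr v) f w.

(* [l2norm f] is +oo exactly when f is not square-summable, so the condition
   [l2norm f <= 1] below includes membership in l^2. *)
Definition l2norm (R : realType) (V : choiceType) (f : V -> R) : \bar R :=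
  ((\esum_(v in [set: V]) ((f v) ^+ 2)%:E) `^ 2^-1)%E.

Definition spectral_radius (R : realType) (V : choiceType)
    (nbr : V -> seq V) : \bar R :=
  ereal_sup [set l2norm (markov nbr f)
            | f in [set f : V -> R | (l2norm f <= 1)%E]].

(* [set_type] carries the topology induced by the inclusion into {0,1}^G,
   the latter having the product topology. *)
Definition chabauty (G : groupType) : topologicalType :=
  set_type [set H : {ptws G -> bool} | group_closed (H : {pred G})].

Definition subgroup_pred (G : groupType) (H : chabauty G) : {pred G} :=
  set_val H.

Lemma subgroup_closed (G : groupType) (H : chabauty G) :
  group_closed (subgroup_pred H).
Proof. exact: set_valP H. Qed.

Definition subgroup_type (G : groupType) (H : chabauty G) : Type :=
  {x : G | subgroup_pred H x}.

HB.instance Definition _ (G : groupType) (H : chabauty G) :=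
  SubChoice.copy (subgroup_type H) {x : G | subgroup_pred H x}.
HB.instance Definition _ (G : groupType) (H : chabauty G) :=
  SubChoice_isSubGroup.Build G (subgroup_pred H) (subgroup_type H)
    (subgroup_closed H).

Section Conjugation.
Local Open Scope group_scope.

(* g^-1 H g *)
Definition conj_pred (G : groupType) (H : chabauty G) (g : G) : {pred G} :=
  fun x => subgroup_pred H (x ^ g^-1).

Lemma conj_closed (G : groupType) (H : chabauty G) (g : G) :
  group_closed (conj_pred H g).
Proof.
have [H1 HB] := subgroup_closed H.
split=> [|x y Hx Hy]; rewrite unfold_in /conj_pred.
  by rewrite conj1g.
by rewrite conjMg conjVg; apply: HB.
Qed.

Definition conj_subgroup (G : groupType) (H : chabauty G) (g : G) :
    chabauty G :=
  exist _ (conj_pred H g : {ptws G -> bool}) (mem_set (conj_closed H g)).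

End Conjugation.

Definition conjugates (G : groupType) (H : chabauty G) : set (chabauty G) :=
  range (conj_subgroup H).

Definition uniformly_recurrent (G : groupType) (H : chabauty G) : Prop :=
  let X := closure (conjugates H) in
  forall K, X K -> X `<=` closure (conjugates K).

Definition symmetric_set (G : groupType) (S : {fset G}) : Prop :=
  forall s, s \in S -> (s^-1)%g \in S.

Definition generating (G : groupType) (S : {fset G}) : Prop :=
  forall K : chabauty G, {subset S <= subgroup_pred K} ->
    forall g, g \in subgroup_pred K.

Definition right_coset (G : groupType) (H : chabauty G) (g : G) : set G :=
  [set (h * g)%g | h in [set` subgroup_pred H]].

Definition coset_space (G : groupType) (H : chabauty G) : choiceType :=
  set_type (range (right_coset H)).

Lemma coset_mul_subproof (G : groupType) (H : chabauty G)
    (x : coset_space H) (s : G) :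
  range (right_coset H) [set (y * s)%g | y in set_val x].
Proof.
have [g _ xE] := set_valP x.
exists (g * s)%g => //.
transitivity [set (y * s)%g | y in right_coset H g]; last by rewrite xE.
rewrite /right_coset image_comp.
by apply: eq_imagel => h _ /=; rewrite mulgA.
Qed.

(* Hg |-> Hgs *)
Definition coset_mul (G : groupType) (H : chabauty G) (x : coset_space H)
    (s : G) : coset_space H :=
  exist _ [set (y * s)%g | y in set_val x] (mem_set (coset_mul_subproof x s)).

Definition cayley_nbr (G : groupType) (S : {fset G}) (g : G) : seq G :=
  [seq (g * s)%g | s <- S].

Definition schreier_nbr (G : groupType) (S : {fset G}) (H : chabauty G)
    (x : coset_space H) : seq (coset_space H) :=
  [seq coset_mul x s | s <- S].

(* [m] is a left-invariant mean on bounded real functions; its values on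
   unbounded functions are irrelevant. *)
Definition amenable (R : realType) (A : groupType) : Prop :=
  exists m : (A -> R) -> R,
    [/\ m (cst 1) = 1,
        forall (c : R) (f g : A -> R), bounded_fun f -> bounded_fun g ->
          m (fun x => c * f x + g x) = c * m f + m g,
        forall f : A -> R, bounded_fun f -> (forall x, 0 <= f x) -> 0 <= m f
      & forall (a : A) (f : A -> R), bounded_fun f ->
          m (fun x => f (a * x)%g) = m f].

(* Main.v *)
(* If v > 0 satisfies Pv <= c v on a regular graph, a weighted Schur test gives
   <Pf, f> <= c |f|^2 - E(f / v) / 2, where E is the Dirichlet form with
   conductances v(x) v(y) / d; hence the spectral radius is at most c, and for
   c above the spectral radius the Green function is such a v. Lifting v from
   the Schreier graph to G gives rho(G) <= rho(H\G). When H is amenable, the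
   geometric mean of the ratios v(gs) / v(g) along H turns a superharmonic v
   on G into Schur weights on the Schreier graph, which gives the converse.

   If H is not amenable, some finite T in H and e > 0 satisfy
   e |u|^2 <= sum_(t in T) |u - u(. t)|^2 for all finitely supported u on G.
   By uniform recurrence every conjugate of H contains one of finitely many
   conjugates of T. Since a lifted v is constant on the cosets Hg, applying the
   inequality in each coset bounds E(f / v) below by a fixed multiple of |f|^2,
   uniformly in c, so rho(G) < rho(H\G). *)

Require Import Defs.
From mathcomp Require Import all_boot all_order all_algebra finmap.
From mathcomp Require Import all_classical all_reals all_analysis.
From mathcomp Require Import lra.

Set Implicit Arguments.
Unset Strict Implicit.
Unset Printing Implicit Defensive.

Import Order.TTheory GRing.Theory Num.Theory.
Import numFieldNormedType.Exports.

Local Open Scope classical_set_scope.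
Local Open Scope ring_scope.

(** * Finitely supported sums *)

Section TotalSum.
Variables (R : realType) (V : choiceType).
Implicit Types (f g : V -> R) (A : {fset V}).

Definition fin_supp f := finite_set [set x | f x != 0].

(** A function of infinite support gets the default value 0, hence the [fin_supp] hypotheses of the
    rules below. *)
Definition tsum f : R := \sum_(x \in [set: V]) f x.

Lemma fin_suppP f :
  fin_supp f <-> exists A, forall x, x \notin A -> f x = 0.
Proof.
split=> [fin|[A fA]]; last first.
  apply: (@sub_finite_set _ _ [set` A]); last exact: finite_fset.
  by move=> x /= fx; apply: contraNT fx => /fA ->.
exists (fset_set [set x | f x != 0]) => x.
by rewrite in_fset_set// notin_setE /= => /negP; rewrite negbK => /eqP.
Qed.

Lemma tsumE A f : (forall x, x \notin A -> f x = 0) ->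
  tsum f = \sum_(x <- A) f x.
Proof.
move=> fA; rewrite /tsum -(@fsbig_widen _ _ _ _ [set` A])//.
- by rewrite fsbig_finite//= set_fsetK.
- by move=> x /= [_ /negP]; exact: fA.
Qed.

Lemma fin_supp_le f g : (forall x, g x = 0 -> f x = 0) -> fin_supp g ->
  fin_supp f.
Proof.
by move=> fg /fin_suppP[A gA]; apply/fin_suppP; exists A => x /gA/fg.
Qed.

Lemma fin_supp2 f g : fin_supp f -> fin_supp g ->
  exists A, (forall x, x \notin A -> f x = 0) /\
            (forall x, x \notin A -> g x = 0).
Proof.
move=> /fin_suppP[A fA] /fin_suppP[B gB]; exists (A `|` B)%fset.
by split=> x; rewrite inE negb_or => /andP[/fA + /gB].
Qed.

Lemma fin_supp0 : fin_supp (fun=> 0).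
Proof. by apply/fin_suppP; exists fset0. Qed.

Lemma fin_suppD f g : fin_supp f -> fin_supp g -> fin_supp (fun x => f x + g x).
Proof.
move=> ff fg; have [A [fA gA]] := fin_supp2 ff fg.
by apply/fin_suppP; exists A => x xA; rewrite fA// gA// addr0.
Qed.

Lemma fin_suppMr f g : fin_supp f -> fin_supp (fun x => f x * g x).
Proof. by apply: fin_supp_le => x ->; rewrite mul0r. Qed.

Lemma fin_suppMl f g : fin_supp f -> fin_supp (fun x => g x * f x).
Proof. by apply: fin_supp_le => x ->; rewrite mulr0. Qed.

Lemma fin_suppN f : fin_supp f -> fin_supp (fun x => - f x).
Proof. by apply: fin_supp_le => x ->; rewrite oppr0. Qed.

Lemma fin_suppB f g : fin_supp f -> fin_supp g -> fin_supp (fun x => f x - g x).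
Proof. by move=> ff fg; apply: fin_suppD ff _; exact: fin_suppN. Qed.

Lemma fin_suppX f n : fin_supp f -> fin_supp (fun x => f x ^+ n.+1).
Proof. by apply: fin_supp_le => x ->; rewrite expr0n. Qed.

Lemma fin_supp_norm f : fin_supp f -> fin_supp (fun x => `|f x|).
Proof. by apply: fin_supp_le => x ->; rewrite normr0. Qed.

Lemma fin_supp_sum (I : eqType) (r : seq I) (F : I -> V -> R) :
  (forall i, i \in r -> fin_supp (F i)) ->
  fin_supp (fun x => \sum_(i <- r) F i x).
Proof.
elim: r => [|i r IH] Fr.
  by under [fun _ => _]eq_fun do rewrite big_nil; exact: fin_supp0.
under [fun _ => _]eq_fun do rewrite big_cons.
apply: fin_suppD; first by apply: Fr; rewrite mem_head.
by apply: IH => j jr; apply: Fr; rewrite in_cons jr orbT.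
Qed.

Lemma fin_supp_delta (a : V) (c : R) :
  fin_supp (fun x => if x == a then c else 0).
Proof.
by apply/fin_suppP; exists [fset a]%fset => x; rewrite inE => /negbTE ->.
Qed.

Lemma tsum0 : tsum (fun=> 0) = 0.
Proof. by rewrite (@tsumE fset0)// big1. Qed.

Lemma tsumD f g : fin_supp f -> fin_supp g ->
  tsum (fun x => f x + g x) = tsum f + tsum g.
Proof.
move=> ff fg; have [A [fA gA]] := fin_supp2 ff fg.
rewrite (tsumE fA) (tsumE gA) (@tsumE A); first by rewrite big_split.
by move=> x xA; rewrite fA// gA// addr0.
Qed.

Lemma tsumZ c f : fin_supp f -> tsum (fun x => c * f x) = c * tsum f.
Proof.
move=> /fin_suppP[A fA]; rewrite (tsumE fA) (@tsumE A) ?mulr_sumr//.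
by move=> x /fA ->; rewrite mulr0.
Qed.

Lemma tsumN f : fin_supp f -> tsum (fun x => - f x) = - tsum f.
Proof.
move=> /fin_suppP[A fA]; rewrite (tsumE fA) (@tsumE A) ?sumrN//.
by move=> x /fA ->; rewrite oppr0.
Qed.

Lemma tsumB f g : fin_supp f -> fin_supp g ->
  tsum (fun x => f x - g x) = tsum f - tsum g.
Proof. by move=> ff fg; rewrite tsumD ?tsumN//; exact: fin_suppN. Qed.

Lemma ler_tsum f g : fin_supp f -> fin_supp g -> (forall x, f x <= g x) ->
  tsum f <= tsum g.
Proof.
move=> ff fg fg_le; have [A [fA gA]] := fin_supp2 ff fg.
by rewrite (tsumE fA) (tsumE gA) ler_sum.
Qed.

Lemma tsum_ge0 f : (forall x, 0 <= f x) -> 0 <= tsum f.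
Proof. by move=> f0; apply: fsumr_ge0. Qed.

Lemma ler_norm_tsum f : fin_supp f -> `|tsum f| <= tsum (fun x => `|f x|).
Proof.
move=> /fin_suppP[A fA]; rewrite (tsumE fA) (@tsumE A) ?ler_norm_sum//.
by move=> x /fA ->; rewrite normr0.
Qed.

Lemma tsum_sum (I : eqType) (r : seq I) (F : I -> V -> R) :
  (forall i, i \in r -> fin_supp (F i)) ->
  tsum (fun x => \sum_(i <- r) F i x) = \sum_(i <- r) tsum (F i).
Proof.
elim: r => [|i r IH] Fr.
  by under [fun _ => _]eq_fun do rewrite big_nil; rewrite tsum0 big_nil.
have Fr' j : j \in r -> fin_supp (F j).
  by move=> jr; apply: Fr; rewrite in_cons jr orbT.
under [fun _ => _]eq_fun do rewrite big_cons.
rewrite tsumD ?IH ?big_cons//; last exact: fin_supp_sum.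
by apply: Fr; rewrite mem_head.
Qed.

Lemma ler_sum_tsum A f : fin_supp f -> (forall x, 0 <= f x) ->
  \sum_(x <- A) f x <= tsum f.
Proof.
move=> ff f0; pose g x := if x \in A then f x else 0.
have gA x : x \notin A -> g x = 0 by rewrite /g => /negbTE ->.
rewrite (_ : \sum_(x <- A) f x = tsum g).
  apply: ler_tsum => // [|x]; first by apply/fin_suppP; exists A.
  by rewrite /g; case: ifP.
rewrite (tsumE gA) big_seq [RHS]big_seq.
by apply: eq_bigr => x xA; rewrite /g xA.
Qed.

Lemma ler_tsum1 x f : fin_supp f -> (forall x, 0 <= f x) -> f x <= tsum f.
Proof.
move=> ff f0; rewrite (le_trans _ (ler_sum_tsum [fset x]%fset ff f0))//.
by rewrite big_seq_fset1.
Qed.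

Lemma tsum_delta (a : V) (c : R) : tsum (fun x => if x == a then c else 0) = c.
Proof.
rewrite (@tsumE [fset a]%fset) ?big_seq_fset1 ?eqxx// => x.
by rewrite inE => /negbTE ->.
Qed.

Lemma fin_supp_reindex (h k : V -> V) f : cancel h k ->
  fin_supp f -> fin_supp (fun x => f (h x)).
Proof.
move=> hk /fin_suppP[A fA]; apply/fin_suppP; exists (k @` A)%fset => x xA.
apply: fA; apply: contra xA => hA; apply/imfsetP.
by exists (h x); rewrite ?hk.
Qed.

Lemma tsum_reindex (h k : V -> V) f : cancel h k -> cancel k h ->
  tsum (fun x => f (h x)) = tsum f.
Proof.
by move=> hk kh; rewrite /tsum [RHS](reindex_fsbigT h)//; exists k.
Qed.

End TotalSum.

(** * Spectral radius and superharmonic functions *)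

Section L2norm.
Variables (R : realType) (V : choiceType).
Implicit Types (f : V -> R) (A : {fset V}).

(** A sum of nonnegative terms is the supremum of its finite partial sums; this replaces the
    extended-real norm by real inequalities. *)
Lemma l2norm_leP f (c : R) : 0 <= c ->
  (l2norm f <= c%:E)%E <-> forall A, \sum_(x <- A) f x ^+ 2 <= c ^+ 2.
Proof.
move=> c0; have esum0 : (0 <= \esum_(v in [set: V]) ((f v) ^+ 2)%:E)%E.
  by apply: esum_ge0 => x _; rewrite lee_fin sqr_ge0.
have -> : (l2norm f <= c%:E)%E =
    (\esum_(v in [set: V]) ((f v) ^+ 2)%:E <= (c ^+ 2)%:E)%E.
  rewrite /l2norm; move: esum0; case: (esum _ _) => [r||]//=.
  - rewrite !lee_fin => r0; rewrite powR12_sqrt//.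
    apply/idP/idP => [rc|rc].
      by rewrite -(sqr_sqrtr r0) lerXn2r// nnegrE sqrtr_ge0.
    by rewrite -(ger0_norm c0) -sqrtr_sqr ler_wsqrtr.
  (* An infinite sum has an infinite root, so both inequalities fail. *)
  - by rewrite invr_eq0 pnatr_eq0 /= !leNgt !ltry.
split=> [le A|le].
  rewrite -lee_fin (le_trans _ le)// esum_ge//.
  exists [set` A]; first by split => //; exact: finite_fset.
  by rewrite fsbig_finite//= set_fsetK sumEFin.
apply: ub_ereal_sup => _ [X [Xfin _] <-].
by rewrite fsbig_finite//= sumEFin lee_fin.
Qed.

Lemma l2norm_le_tsum f (c : R) : 0 <= c -> fin_supp f ->
  (l2norm f <= c%:E)%E <-> tsum (fun x => f x ^+ 2) <= c ^+ 2.
Proof.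
move=> c0 ff; apply: (iff_trans (l2norm_leP _ c0)); split=> [le|le A].
  have /fin_suppP[A fA] := ff.
  by rewrite (@tsumE _ _ A) => [|x /fA ->]; rewrite ?expr0n.
apply: le_trans le; apply: ler_sum_tsum => [|x]; last exact: sqr_ge0.
exact: fin_suppX.
Qed.

End L2norm.

(* Cayley and Schreier graphs are treated together: x is joined to [a x s]
   for each s in S, and the edge is reversed by s^-1. *)
Section LabelledGraph.
Variables (R : realType) (G : groupType) (S : {fset G}) (V : choiceType).
Variable a : V -> G -> V.
Hypothesis S_sym : symmetric_set S.
Hypothesis aK : forall s, s \in S -> cancel (a^~ s) (a^~ (s^-1)%g).
Implicit Types (f g v : V -> R) (x : V) (s : G).

Definition lnbr x : seq V := [seq a x s | s <- S].
Definition nsum f x := \sum_(s <- S) f (a x s).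
Local Notation d := (#|` S|%:R : R).

Lemma markov_lnbr f x : Defs.markov lnbr f x = d^-1 * nsum f x.
Proof. by rewrite /Defs.markov /lnbr size_map big_map. Qed.

Lemma nsum_markov f x : nsum f x = d * Defs.markov lnbr f x.
Proof.
rewrite markov_lnbr; have [S0|S0] := eqVneq #|` S| 0%N.
  by rewrite /nsum (cardfs0_eq S0) big_seq_fset0 cardfs0 mul0r.
by rewrite mulrA divff ?mul1r// pnatr_eq0.
Qed.

Lemma aVK s : s \in S -> cancel (a^~ (s^-1)%g) (a^~ s).
Proof. by move=> /S_sym/aK; rewrite invgK. Qed.

Lemma sum_invg (F : G -> R) : \sum_(s <- S) F (s^-1)%g = \sum_(s <- S) F s.
Proof.
rewrite -(big_map (fun s : G => s^-1)%g xpredT F); apply: perm_big.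
apply: uniq_perm; rewrite ?fset_uniq//.
  by rewrite map_inj_uniq ?fset_uniq//; exact: invg_inj.
move=> s; apply/mapP/idP => [[t tS ->]|sS]; first exact: S_sym.
by exists (s^-1)%g; rewrite ?invgK//; exact: S_sym.
Qed.

Lemma fin_supp_act f s : s \in S -> fin_supp f -> fin_supp (fun x => f (a x s)).
Proof. by move=> sS; apply: fin_supp_reindex (aK sS). Qed.

Lemma tsum_act f s : s \in S -> tsum (fun x => f (a x s)) = tsum f.
Proof. by move=> sS; apply: tsum_reindex (aK sS) (aVK sS). Qed.

Lemma fin_supp_nsum f : fin_supp f -> fin_supp (nsum f).
Proof. by move=> ff; apply: fin_supp_sum => s sS; apply: fin_supp_act. Qed.

Lemma fin_supp_markov f : fin_supp f -> fin_supp (Defs.markov lnbr f).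
Proof.
move=> ff; rewrite (_ : Defs.markov _ _ = fun x => d^-1 * nsum f x); last first.
  by apply/funext => x; exact: markov_lnbr.
by apply: fin_suppMl; exact: fin_supp_nsum.
Qed.

(** Edge reversal, (x, s) |-> (a x s, s^-1), permutes the labelled edges: each [a^~ s] is a
    bijection and S is symmetric. *)
Lemma tsum_edge (F : V -> G -> R) : (forall s, s \in S -> fin_supp (F^~ s)) ->
  tsum (fun x => \sum_(s <- S) F (a x s) (s^-1)%g) =
  tsum (fun x => \sum_(s <- S) F x s).
Proof.
move=> Ff; rewrite !tsum_sum//; last first.
  move=> s sS; apply: (fin_supp_act (f := F^~ (s^-1)%g)) => //.
  exact/Ff/S_sym.
rewrite -[RHS](sum_invg (fun s => tsum (F^~ s))) big_seq [RHS]big_seq.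
by apply: eq_bigr => s sS; rewrite (tsum_act (F^~ (s^-1)%g)).
Qed.

Lemma nsum_adjoint f g : fin_supp f ->
  tsum (fun x => f x * nsum g x) = tsum (fun x => nsum f x * g x).
Proof.
move=> ff; rewrite /nsum.
under [fun x => f x * _]eq_fun do rewrite mulr_sumr.
under [fun x => _ * g x]eq_fun do rewrite mulr_suml.
rewrite -(tsum_edge (F := fun x s => f x * g (a x s))); last first.
  by move=> s sS; apply: fin_suppMr.
congr tsum; apply/funext => x; rewrite big_seq [RHS]big_seq.
by apply: eq_bigr => s sS; rewrite aK.
Qed.

Lemma spectral_radius_le (c : R) : 0 <= c ->
  (forall f, (l2norm f <= 1)%E -> (l2norm (Defs.markov lnbr f) <= c%:E)%E) ->
  (spectral_radius R lnbr <= c%:E)%E.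
Proof. by move=> c0 le; apply: ub_ereal_sup => _ [f f1 <-]; exact: le. Qed.

Lemma spectral_radius_ge0 : (0 <= spectral_radius R lnbr)%E.
Proof.
apply: (@le_trans _ _ (l2norm (Defs.markov lnbr (fun=> 0 : R)))).
  exact: poweR_ge0.
apply: ereal_sup_ubound; exists (fun=> 0) => //=.
apply/l2norm_leP => // A; rewrite big1 ?expr1n// => x _.
by rewrite expr0n.
Qed.

(* Polarisation, with |f - g| in place of f - g because the quadratic form is
   only controlled on nonnegative functions. *)
Lemma quadratic_bilinear (c : R) f g : 0 <= c ->
  (forall h, fin_supp h -> (forall x, 0 <= h x) ->
    tsum (fun x => h x * nsum h x) <= c * tsum (fun x => h x ^+ 2)) ->
  fin_supp f -> fin_supp g -> (forall x, 0 <= f x) -> (forall x, 0 <= g x) ->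
  2 * tsum (fun x => g x * nsum f x) <=
    c * (tsum (fun x => f x ^+ 2) + tsum (fun x => g x ^+ 2)).
Proof.
move=> c0 Q ff fg f0 g0; pose p x := f x + g x; pose m x := `|f x - g x|.
have fp : fin_supp p by exact: fin_suppD.
have fm : fin_supp m by apply: fin_supp_norm; exact: fin_suppB.
have p0 x : 0 <= p x by rewrite addr_ge0.
have m0 x : 0 <= m x by exact: normr_ge0.
have Qp := Q p fp p0; have Qm := Q m fm m0.
have : tsum (fun x => 2 * (f x * nsum g x + g x * nsum f x)) <=
       tsum (fun x => p x * nsum p x + m x * nsum m x).
  apply: ler_tsum => [||x].
  - by apply/fin_suppMl/fin_suppD; exact: fin_suppMr.
  - by apply/fin_suppD; exact: fin_suppMr.
  - rewrite /nsum !mulr_sumr -!big_split/= mulr_sumr; apply: ler_sum => s _.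
    have := ler_norm (- ((f x - g x) * (f (a x s) - g (a x s)))).
    by rewrite normrN normrM /p /m; lra.
rewrite tsumZ; last by apply/fin_suppD; exact: fin_suppMr.
rewrite tsumD; [|exact: fin_suppMr..].
rewrite tsumD; [|exact: fin_suppMr..].
have -> : tsum (fun x => f x * nsum g x) = tsum (fun x => g x * nsum f x).
  by rewrite nsum_adjoint//; congr tsum; apply/funext => x; rewrite mulrC.
move=> le.
have : tsum (fun x => p x ^+ 2) + tsum (fun x => m x ^+ 2) =
    2 * (tsum (fun x => f x ^+ 2) + tsum (fun x => g x ^+ 2)).
  rewrite -tsumD; [|exact: fin_suppX..].
  rewrite -tsumD; [|exact: fin_suppX..].
  rewrite -tsumZ; last by apply: fin_suppD; exact: fin_suppX.
  by congr tsum; apply/funext => x; rewrite /m /p real_normK ?num_real//; lra.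
by nra.
Qed.

(** To bound Pf on a finite set A, put g = c^-1 P|f| on A and let phi be |f| cut off to the
    neighbours of A. The polarised inequality becomes 2 d c |g|^2 <= d c (|phi|^2 + |g|^2), so |g|
    <= |phi| <= 1. *)
Lemma spectral_radius_le_quadratic (c : R) : 0 < c ->
  (forall f, fin_supp f -> (forall x, 0 <= f x) ->
    tsum (fun x => f x * nsum f x) <= d * c * tsum (fun x => f x ^+ 2)) ->
  (spectral_radius R lnbr <= c%:E)%E.
Proof.
move=> c0 Q; apply: spectral_radius_le (ltW c0) _ => f f1.
apply/(l2norm_leP _ (ltW c0)) => A.
pose B := [fset a y s | y in A, s in S]%fset.
pose phi x := if x \in B then `|f x| else 0.
pose g x := if x \in A then c^-1 * Defs.markov lnbr (fun y => `|f y|) x else 0.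
have phi0 x : 0 <= phi x by rewrite /phi; case: ifP.
have g0 x : 0 <= g x.
  rewrite /g; case: ifP => // _; rewrite mulr_ge0 ?invr_ge0 ?(ltW c0)//.
  by rewrite markov_lnbr mulr_ge0 ?invr_ge0// sumr_ge0.
have phiB x : x \notin B -> phi x = 0 by rewrite /phi => /negbTE ->.
have gA x : x \notin A -> g x = 0 by rewrite /g => /negbTE ->.
have fphi : fin_supp phi by apply/fin_suppP; exists B.
have fg : fin_supp g by apply/fin_suppP; exists A.
have phi1 : tsum (fun x => phi x ^+ 2) <= 1.
  rewrite (@tsumE _ _ B) => [|x /phiB ->]; last by rewrite expr0n.
  have /(l2norm_leP _ ler01)/(_ B) := f1; rewrite expr1n; apply: le_trans.
  rewrite big_seq [leRHS]big_seq; apply: ler_sum => x xB.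
  by rewrite /phi xB real_normK// num_real.
have gE : tsum (fun x => g x * nsum phi x) = d * c * tsum (fun x => g x ^+ 2).
  rewrite -tsumZ; last exact: fin_suppX.
  congr tsum; apply/funext => x; rewrite expr2 mulrCA.
  have [xA|/gA ->] := boolP (x \in A); last by rewrite !mul0r.
  congr (_ * _); rewrite /g xA -mulrA mulVKf ?gt_eqF// -nsum_markov.
  rewrite /nsum big_seq [RHS]big_seq; apply: eq_bigr => s sS.
  by rewrite /phi ifT//; apply/imfset2P; exists x => //; exists s.
have := quadratic_bilinear (mulr_ge0 (ler0n _ _) (ltW c0)) Q fphi fg phi0 g0.
rewrite gE => le.
have g1 : tsum (fun x => g x ^+ 2) <= 1.
  (* For empty S the factor d cannot be cancelled, but then d^-1 = 0 and g vanishes. *)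
  have [d0|d0] := eqVneq d 0.
    rewrite (_ : (fun x => _) = fun=> 0) ?tsum0//; apply/funext => x.
    rewrite /g; case: ifP => _; last by rewrite expr0n.
    by rewrite markov_lnbr d0 invr0 mul0r mulr0 expr0n.
  have dc : 0 < d * c by rewrite mulr_gt0// lt0r d0 ler0n.
  rewrite -(ler_pM2l dc); nra.
apply: (@le_trans _ _ (c ^+ 2 * tsum (fun x => g x ^+ 2))); last first.
  by rewrite ler_piMr// sqr_ge0.
rewrite (@tsumE _ _ A) => [|x /gA ->]; last by rewrite expr0n.
rewrite mulr_sumr big_seq [leRHS]big_seq; apply: ler_sum => x xA.
rewrite /g xA -exprMn mulVKf ?gt_eqF// -[leLHS]real_normK ?num_real//.
rewrite lerXn2r ?nnegrE//.
  by rewrite markov_lnbr mulr_ge0 ?invr_ge0// sumr_ge0.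
rewrite !markov_lnbr normrM ger0_norm ?invr_ge0//.
by rewrite ler_wpM2l ?invr_ge0// ler_norm_sum.
Qed.

End LabelledGraph.

Section SpectralTests.
Variables (R : realType) (G : groupType) (S : {fset G}) (V : choiceType).
Variable a : V -> G -> V.
Hypothesis S_sym : symmetric_set S.
Hypothesis aK : forall s, s \in S -> cancel (a^~ s) (a^~ (s^-1)%g).
Implicit Types (f g v : V -> R) (x : V) (s : G).
Local Notation d := (#|` S|%:R : R).
Local Notation P := (Defs.markov (lnbr S a)).
Local Notation N := (nsum S a).

(** By homogeneity, f is scaled into the unit ball that defines the spectral radius; f = 0 is
    treated apart. *)
Lemma tsum_markov_le (c : R) f : 0 <= c ->
  (spectral_radius R (lnbr S a) <= c%:E)%E -> fin_supp f ->
  tsum (fun x => P f x ^+ 2) <= c ^+ 2 * tsum (fun x => f x ^+ 2).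
Proof.
move=> c0 rho_c ff; set t := tsum (fun x => f x ^+ 2).
have t0 : 0 <= t by apply: tsum_ge0 => x; exact: sqr_ge0.
have fP : fin_supp (P f) by exact: fin_supp_markov.
have [tz|tn0] := eqVneq t 0.
  have f0 x : f x = 0.
    apply/eqP; rewrite -sqrf_eq0 eq_le sqr_ge0 andbT -tz.
    by apply: (@ler_tsum1 _ _ x (fun x => f x ^+ 2)) => [|y];
      [exact: fin_suppX|exact: sqr_ge0].
  rewrite tz mulr0 (_ : (fun x => _) = fun=> 0) ?tsum0//; apply/funext => x.
  by rewrite markov_lnbr /nsum big1 ?mulr0 ?expr0n.
pose r := Num.sqrt t; have r0 : 0 < r by rewrite sqrtr_gt0 lt0r tn0.
have rr : r ^+ 2 = t by rewrite sqr_sqrtr.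
pose g x := r^-1 * f x.
have PgE x : P g x = r^-1 * P f x.
  by rewrite !markov_lnbr mulrCA; congr (_ * _); rewrite /nsum mulr_sumr.
have fg : fin_supp g by exact: fin_suppMl.
have g1 : (l2norm g <= 1%:E)%E.
  apply/(l2norm_le_tsum ler01 fg).
  under [fun x => _]eq_fun do rewrite exprMn.
  by rewrite tsumZ; [rewrite exprVn rr mulVf ?expr1n|exact: fin_suppX].
have : (l2norm (P g) <= c%:E)%E.
  by apply: le_trans rho_c; apply: ereal_sup_ubound; exists g.
move=> /l2norm_le_tsum => /(_ c0 (fin_supp_markov aK fg)).
under [fun x => _]eq_fun do rewrite PgE exprMn.
rewrite tsumZ; last exact: fin_suppX.
by rewrite exprVn rr ler_pdivrMl 1?mulrC// lt0r tn0.
Qed.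

Section Green.
Variable o : V.
(** Connectedness of the graph, as induction along edges from o; it makes the Green function
    positive everywhere. *)
Hypothesis conn : forall Q : V -> Prop, Q o ->
  (forall x s, s \in S -> Q x -> Q (a x s)) -> forall x, Q x.

Let p n : V -> R := iter n P (fun x => if x == o then 1 else 0).

Let fin_supp_p n : fin_supp (p n).
Proof.
elim: n => [|n IH]; first exact: fin_supp_delta.
rewrite /p iterS. exact: (fin_supp_markov aK IH).
Qed.

Let p_ge0 n x : 0 <= p n x.
Proof.
elim: n x => [|n IH] x; first by rewrite /p /=; case: ifP.
rewrite /p iterS markov_lnbr mulr_ge0 ?invr_ge0//.
by apply: sumr_ge0 => s _; exact: IH.
Qed.

(** A value is at most the l^2 norm, and each application of P multiplies this norm by at most r. *)
Let p_le (r : R) n x : 0 <= r -> (spectral_radius R (lnbr S a) <= r%:E)%E ->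
  p n x <= r ^+ n.
Proof.
move=> r0 rho_r; rewrite -(@ler_pXn2r _ 2) ?nnegrE ?exprn_ge0//.
apply: (@le_trans _ _ (tsum (fun x => p n x ^+ 2))).
  by apply: (@ler_tsum1 _ _ x (fun x => p n x ^+ 2)) => [|y];
    [exact: fin_suppX|exact: sqr_ge0].
elim: n => [|n IH].
  rewrite (_ : (fun x => _) = (fun x => if x == o then 1 else 0)).
    by rewrite tsum_delta expr1n.
  by apply/funext => y; rewrite /p /=; case: ifP; rewrite ?expr1n ?expr0n.
rewrite /p; under [fun x => _]eq_fun do rewrite iterS.
apply: le_trans (tsum_markov_le r0 rho_r (fin_supp_p n)) _.
by rewrite [r ^+ n.+1]exprS exprMn ler_wpM2l ?sqr_ge0.
Qed.

(* v is the Green function \sum_n c^-n P^n delta_o, which converges because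
   P^n delta_o is bounded by the n-th power of the spectral radius. *)
Lemma exists_superharmonic (c : R) : (spectral_radius R (lnbr S a) < c%:E)%E ->
  exists2 v : V -> R, (forall x, 0 < v x) & forall x, N v x <= d * c * v x.
Proof.
move=> rho_c; have rho0 := spectral_radius_ge0 R S a.
have [r [r0 rho_r rc]] : exists r : R, [/\ 0 <= r,
    (spectral_radius R (lnbr S a) <= r%:E)%E & r < c].
  exists (fine (spectral_radius R (lnbr S a))).
  have fin : spectral_radius R (lnbr S a) \is a fin_num.
    by rewrite ge0_fin_numE// (lt_trans rho_c)// ltry.
  by split; [exact: fine_ge0|rewrite fineK|rewrite -lte_fin fineK].
have c0 : 0 < c by exact: le_lt_trans rc.
(* The Green series is dominated by the geometric series of ratio q < 1. *)
pose q := r / c; have q0 : 0 <= q by rewrite divr_ge0// ltW.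
have q1 : q < 1 by rewrite ltr_pdivrMr// mul1r.
pose u (x : V) (n : nat) : R := \sum_(i < n) c ^- i * p i x.
have u_nd x : nondecreasing_seq (u x).
  apply/nondecreasing_seqP => n; rewrite /u big_ord_recr/= lerDl.
  by rewrite mulr_ge0// invr_ge0 exprn_ge0// ltW.
have u_ub x n : u x n <= (1 - q)^-1.
  apply: (@le_trans _ _ (\sum_(i < n) q ^+ i)).
    apply: ler_sum => i _; rewrite /q expr_div_n mulrC ler_wpM2r//.
      by rewrite invr_ge0 exprn_ge0// ltW.
    exact: p_le.
  have q1' : 0 < 1 - q by rewrite subr_gt0.
  rewrite -[leRHS]mul1r ler_pdivlMr// mulrC -opprB mulNr -subrX1 opprB.
  by rewrite gerBl exprn_ge0.
have u_cvg x : cvgn (u x).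
  apply: nondecreasing_is_cvgn => //; exists (1 - q)^-1 => _ [n _ <-].
  exact: u_ub.
pose v x := limn (u x).
have u_le x n : u x n <= v x by exact: nondecreasing_cvgn_le.
exists v => x.
  have [n pn] : exists n, 0 < p n x.
    move: x; apply: conn => [|x s sS [n pn]].
      by exists 0%N; rewrite /p/= eqxx.
    exists n.+1; rewrite /p iterS markov_lnbr.
    have d0 : 0 < d by rewrite ltr0n cardfs_gt0; apply/fset0Pn; exists s.
    rewrite mulr_gt0 ?invr_gt0//; apply: lt_le_trans pn _.
    have S's := S_sym sS.
    rewrite /nsum (big_fsetD1 _ S's)/= aK// lerDl.
    by apply: sumr_ge0 => *; exact: p_ge0.
  apply: lt_le_trans (u_le x n.+1); rewrite /u big_ord_recr/=.
  rewrite ltr_wpDl// ?mulr_gt0 ?invr_gt0 ?exprn_gt0//.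
  by apply: sumr_ge0 => i _; rewrite mulr_ge0// invr_ge0 exprn_ge0// ltW.
(* Applying P shifts the series by one index: N maps the n-th partial sum to d c times the next one
   without its term of index 0. *)
have Nu n : \sum_(s <- S) u (a x s) n <= d * c * v x.
  have -> : \sum_(s <- S) u (a x s) n =
      d * c * \sum_(i < n) c ^- i.+1 * p i.+1 x.
    rewrite /u exchange_big/= mulr_sumr; apply: eq_bigr => i _.
    rewrite -mulr_sumr -/(nsum S a (p i) x) nsum_markov -/(p i.+1 x).
    rewrite exprS invfM !mulrA; congr (_ * _).
    by rewrite [d * c * c^-1]mulfK ?gt_eqF// [c ^- i * _]mulrC.
  rewrite ler_wpM2l ?mulr_ge0 ?(ltW c0)//; apply: le_trans (u_le x n.+1).
  by rewrite /u big_ord_recl lerDr expr0 invr1 mul1r; exact: (p_ge0 0%N).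
have Ncvg : (fun n => \sum_(s <- S) u (a x s) n) @ \oo --> N v x.
  rewrite /nsum; apply: cvg_big => [|s _].
  exact: add_continuous.
exact: u_cvg.
apply: (cvgr_to_le Ncvg); near=> n; exact: Nu.
Unshelve. all: by end_near. Qed.

End Green.

(* The quadratic form is compared edge by edge through
   2 * f x * f y = k * f x ^+ 2 + k^-1 * f y ^+ 2 - k * (f x - k^-1 * f y) ^+ 2,
   where the weight k is inverted when the edge is reversed. *)
Lemma weighted_schur (c : R) (k : V -> G -> R) f :
  (forall x s, s \in S -> 0 < k x s) ->
  (forall x s, s \in S -> k (a x s) (s^-1)%g = (k x s)^-1) ->
  (forall x, \sum_(s <- S) k x s <= d * c) ->
  fin_supp f ->
  tsum (fun x => f x * N f x) +
    2^-1 * tsum (fun x =>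
      \sum_(s <- S) k x s * (f x - (k x s)^-1 * f (a x s)) ^+ 2)
  <= d * c * tsum (fun x => f x ^+ 2).
Proof.
move=> k0 kV kc ff.
have ffX : fin_supp (fun x => f x ^+ 2) by exact: fin_suppX.
have fa s : s \in S -> fin_supp (fun x => f (a x s)).
  by move=> sS; exact: (fin_supp_act aK sS ff).
have f1 : fin_supp (fun x => \sum_(s <- S) k x s * f x ^+ 2).
  by apply: fin_supp_sum => s _; exact: fin_suppMl.
have f2 : fin_supp (fun x => \sum_(s <- S) (k x s)^-1 * f (a x s) ^+ 2).
  by apply: fin_supp_sum => s sS; apply/fin_suppMl/fin_suppX/fa.
have f3 : fin_supp (fun x =>
    \sum_(s <- S) k x s * (f x - (k x s)^-1 * f (a x s)) ^+ 2).
  apply: fin_supp_sum => s sS; apply/fin_suppMl/fin_suppX/fin_suppB => //.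
  exact/fin_suppMl/fa.
(* Reversing every edge inverts k and exchanges its ends, so both square terms have the same total.
   Averaging the two makes the comparison below termwise. *)
have E : tsum (fun x => \sum_(s <- S) (k x s)^-1 * f (a x s) ^+ 2) =
         tsum (fun x => \sum_(s <- S) k x s * f x ^+ 2).
  rewrite -(tsum_edge S_sym aK (F := fun x s => k x s * f x ^+ 2)); last first.
    by move=> s _; exact: fin_suppMl.
  congr tsum; apply/funext => x; rewrite big_seq [RHS]big_seq.
  by apply: eq_bigr => s sS; rewrite kV.
have le : tsum (fun x => \sum_(s <- S) k x s * f x ^+ 2) <=
          d * c * tsum (fun x => f x ^+ 2).
  rewrite -tsumZ//; apply: ler_tsum => // [|x]; first exact: fin_suppMl.
  by rewrite -mulr_suml ler_wpM2r ?sqr_ge0.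
apply: le_trans le; rewrite -tsumZ// -tsumD; last 2 first.
- exact: fin_suppMr.
- exact: fin_suppMl.
have -> : tsum (fun x => \sum_(s <- S) k x s * f x ^+ 2) = tsum (fun x => 
    2^-1 * (\sum_(s <- S) k x s * f x ^+ 2) +
    2^-1 * (\sum_(s <- S) (k x s)^-1 * f (a x s) ^+ 2)).
  rewrite tsumD; [|exact: fin_suppMl..].
  by rewrite !tsumZ// E; lra.
apply: ler_tsum => [||x].
- by apply: fin_suppD; [exact: fin_suppMr|exact: fin_suppMl].
- by apply: fin_suppD; exact: fin_suppMl.
- rewrite /nsum !mulr_sumr -!big_split/= big_seq [leRHS]big_seq.
  apply: ler_sum => s sS; have := k0 x s sS; set K := k x s => K0.
  have KV : K * K^-1 = 1 by rewrite divff// gt_eqF.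
  set y := f (a x s); set L := K^-1 in KV *.
  have -> : K * (f x - L * y) ^+ 2 =
      K * f x ^+ 2 - 2 * (K * L) * f x * y + (K * L) * L * y ^+ 2 by lra.
  rewrite KV; lra.
Qed.

End SpectralTests.

Section RightTranslation.
Variables (R : realType) (G : groupType).
Implicit Types (f : G -> R) (t : G).

Lemma rmulK t : cancel (fun g : G => (g * t)%g) (fun g => (g * t^-1)%g).
Proof. by move=> g; rewrite mulgK. Qed.

Lemma fin_supp_shift f t : fin_supp f -> fin_supp (fun g => f (g * t)%g).
Proof. exact: (fin_supp_reindex (h := fun g => (g * t)%g) (rmulK t)). Qed.

Lemma tsum_shift f t : tsum (fun g => f (g * t)%g) = tsum f.
Proof.
apply: (tsum_reindex (h := fun g => (g * t)%g) (k := fun g => (g * t^-1)%g)).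
  exact: rmulK.
by move=> g; rewrite mulgVK.
Qed.

End RightTranslation.

(** * Comparison of spectral radii *)

Section SpectralRadiusBounds.
Variables (R : realType) (G : groupType) (S : {fset G}).
Hypothesis S_sym : symmetric_set S.

(** Schur test with the weights v(xs) / v(x), whose row sums are controlled by superharmonicity; the
    nonnegative energy term is dropped. *)
Lemma spectral_radius_le_superharmonic (V : choiceType) (a : V -> G -> V)
    (v : V -> R) (c : R) :
  (forall s, s \in S -> cancel (a^~ s) (a^~ (s^-1)%g)) ->
  0 < c -> (forall x, 0 < v x) ->
  (forall x, nsum S a v x <= #|` S|%:R * c * v x) ->
  (spectral_radius R (lnbr S a) <= c%:E)%E.
Proof.
move=> aK c0 v0 vc.
apply: (spectral_radius_le_quadratic S_sym aK c0) => f ff f0.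
pose k x s := v (a x s) / v x.
have k0 x s : 0 < k x s by rewrite divr_gt0.
apply: le_trans (weighted_schur S_sym aK (k := k) _ _ _ ff) => //.
- rewrite lerDl mulr_ge0// tsum_ge0// => x; apply: sumr_ge0 => s _.
  by rewrite mulr_ge0 ?sqr_ge0//; exact: ltW.
- by move=> x s sS; rewrite /k aK// invf_div.
- by move=> x; rewrite -mulr_suml ler_pdivrMr//; exact: vc.
Qed.

(** The constant 1 is superharmonic for c = 1, so the spectral radius is at most 1. *)
Lemma spectral_radius_fin_num (V : choiceType) (a : V -> G -> V) :
  (forall s, s \in S -> cancel (a^~ s) (a^~ (s^-1)%g)) ->
  spectral_radius R (lnbr S a) \is a fin_num.
Proof.
move=> aK; rewrite ge0_fin_numE ?spectral_radius_ge0//.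
have le1 : (spectral_radius R (lnbr S a) <= 1%:E)%E.
  apply: (@spectral_radius_le_superharmonic _ _ (fun=> 1)) => // x.
  rewrite /nsum big_const_seq count_predT iter_addr_0 !mulr1.
  exact: lexx.
exact: le_lt_trans le1 (ltry _).
Qed.

(** Reduces a comparison to values c strictly above one radius, where a Green function is
    available. *)
Lemma spectral_radius_le_gt (V W : choiceType) (a : V -> G -> V)
    (b : W -> G -> W) :
  (forall s, s \in S -> cancel (a^~ s) (a^~ (s^-1)%g)) ->
  (forall s, s \in S -> cancel (b^~ s) (b^~ (s^-1)%g)) ->
  (forall c : R, 0 < c -> (spectral_radius R (lnbr S b) < c%:E)%E ->
    (spectral_radius R (lnbr S a) <= c%:E)%E) ->
  (spectral_radius R (lnbr S a) <= spectral_radius R (lnbr S b))%E.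
Proof.
move=> /spectral_radius_fin_num aF /spectral_radius_fin_num bF le.
rewrite -(fineK aF) -(fineK bF) lee_fin; apply/ler_addgt0Pr => e e0.
rewrite -lee_fin (fineK aF); apply: le.
  by rewrite ltr_wpDl// fine_ge0// spectral_radius_ge0.
by rewrite -{1}(fineK bF) lte_fin ltrDl.
Qed.

End SpectralRadiusBounds.

(** [generating] speaks of subgroups, and Q need not be one. The elements whose right translation
    preserves Q form a subgroup, which contains S. *)
Lemma generating_ind (G : groupType) (S : {fset G}) (Q : G -> Prop) :
  symmetric_set S -> generating S -> Q 1%g ->
  (forall g s, s \in S -> Q g -> Q (g * s)%g) -> forall g, Q g.
Proof.
move=> S_sym genS Q1 QS g.
pose K : {ptws G -> bool} := fun x => `[< forall y, Q y <-> Q (y * x)%g >].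
have Kg : group_closed (K : {pred G}).
  split=> [|x y /asboolP Kx /asboolP Ky]; apply/asboolP => z.
    by rewrite mulg1.
  rewrite mulgA; apply: (iff_trans (Kx z)).
  by apply: iff_sym; apply: (iff_trans (Ky _)); rewrite mulgVK.
have := genS (exist _ K (mem_set Kg)) _ g.
have SK : {subset S <= subgroup_pred (exist _ K (mem_set Kg) : chabauty G)}.
  move=> s sS; apply/asboolP => y; split; first exact: QS.
  by move=> /(QS _ _ (S_sym _ sS)); rewrite mulgK.
by move=> /(_ SK)/asboolP/(_ 1%g); rewrite mul1g => -[+ _]; exact.
Qed.

(** * Right cosets of a subgroup *)

Section Cosets.
Variables (G : groupType) (H : chabauty G).
Implicit Types (x : coset_space H) (g h s : G).

Lemma subgroup1 : subgroup_pred H 1%g.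
Proof. by have [] := subgroup_closed H. Qed.

Lemma subgroupV h : subgroup_pred H h -> subgroup_pred H h^-1%g.
Proof.
have [H1 HB] := subgroup_closed H.
by move=> Hh; rewrite -[h^-1%g]mul1g; exact: HB.
Qed.

Lemma subgroupM g h : subgroup_pred H g -> subgroup_pred H h ->
  subgroup_pred H (g * h)%g.
Proof.
have [H1 HB] := subgroup_closed H.
by move=> Hg /subgroupV Hh; rewrite -[h]invgK; exact: HB.
Qed.

Definition coset_of g : coset_space H :=
  exist _ (right_coset H g) (mem_set (ex_intro2 _ _ g I erefl)).

Lemma coset_eqP g g' :
  coset_of g = coset_of g' <-> exists2 h, subgroup_pred H h & g' = (h * g)%g.
Proof.
split=> [[E]|[h Hh ->]].
  have : right_coset H g g'.
    by rewrite E; exists 1%g; [exact: subgroup1|rewrite mul1g].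
  by move=> [h Hh <-]; exists h.
apply: val_inj => /=; apply/seteqP; split=> _ [k Hk <-].
  exists (k * h^-1)%g; last by rewrite -!mulgA mulKg.
  by apply: subgroupM => //; exact: subgroupV.
by exists (k * h)%g; [exact: subgroupM|rewrite mulgA].
Qed.

Lemma coset_of_mul g s : coset_mul (coset_of g) s = coset_of (g * s)%g.
Proof.
apply: val_inj => /=; rewrite /right_coset image_comp.
by apply: eq_imagel => h _ /=; rewrite mulgA.
Qed.

Lemma coset_ofP x : exists g, coset_of g = x.
Proof.
by have [g _ xE] := set_valP x; exists g; apply: val_inj.
Qed.

Definition coset_rep x : G := sval (cid (coset_ofP x)).

Lemma coset_repK : cancel coset_rep coset_of.
Proof. by move=> x; rewrite /coset_rep; case: cid. Qed.

Lemma coset_mulK s : cancel (@coset_mul G H ^~ s) (@coset_mul G H ^~ s^-1%g).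
Proof.
by move=> x; have [g <-] := coset_ofP x; rewrite !coset_of_mul mulgK.
Qed.

End Cosets.

(** * Amenable subgroups *)

Lemma bounded_funP (R : realType) (T : Type) (f : T -> R) :
  bounded_fun f <-> exists M, forall x, `|f x| <= M.
Proof.
split=> [[M [Mreal fM]]|[M fM]].
  by exists (M + 1) => x; apply: fM => //; rewrite ltrDl.
exists M; split=> [|N MN x _]; first exact: num_real.
exact: le_trans (fM x) (ltW MN).
Qed.

(** * Finitely additive means and Jensen's inequality *)

Section Mean.
Variables (R : realType) (T : Type) (m : (T -> R) -> R).
Hypothesis m1 : m (cst 1) = 1.
Hypothesis m_lin : forall (c : R) (f g : T -> R),
  bounded_fun f -> bounded_fun g -> m (fun x => c * f x + g x) = c * m f + m g.
Hypothesis m_ge0 : forall f : T -> R, bounded_fun f -> (forall x, 0 <= f x) ->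
  0 <= m f.
Implicit Types f g : T -> R.

Lemma bounded_cst (c : R) : bounded_fun (fun _ : T => c).
Proof. by apply/bounded_funP; exists `|c|. Qed.

Lemma mean0 : m (fun=> 0) = 0.
Proof.
have := m_lin 1 (bounded_cst 0) (bounded_cst 0).
rewrite (_ : (fun _ => _) = fun=> 0); first by lra.
by apply/funext => x; rewrite mul1r addr0.
Qed.

Lemma meanZ (c : R) f : bounded_fun f -> m (fun x => c * f x) = c * m f.
Proof.
move=> bf; rewrite -[RHS]addr0 -mean0 -m_lin//; last exact: bounded_cst.
by congr m; apply/funext => x; rewrite addr0.
Qed.

Lemma meanD f g : bounded_fun f -> bounded_fun g ->
  m (fun x => f x + g x) = m f + m g.
Proof.
move=> bf bg; rewrite -[m f]mul1r -m_lin//.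
by congr m; apply/funext => x; rewrite mul1r.
Qed.

Lemma mean_cst (c : R) : m (fun=> c) = c.
Proof.
rewrite -[RHS]mulr1 -m1 -meanZ; last exact: bounded_cst.
by congr m; apply/funext => x; rewrite /= mulr1.
Qed.

Lemma bounded_funD f g : bounded_fun f -> bounded_fun g ->
  bounded_fun (fun x => f x + g x).
Proof.
move=> /bounded_funP[M fM] /bounded_funP[N gN]; apply/bounded_funP.
by exists (M + N) => x; rewrite (le_trans (ler_normD _ _))// lerD.
Qed.

Lemma bounded_funZ (c : R) f : bounded_fun f -> bounded_fun (fun x => c * f x).
Proof.
move=> /bounded_funP[M fM]; apply/bounded_funP.
by exists (`|c| * M) => x; rewrite normrM ler_wpM2l.
Qed.

Lemma le_mean f g : bounded_fun f -> bounded_fun g -> (forall x, f x <= g x) ->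
  m f <= m g.
Proof.
move=> bf bg fg; rewrite -subr_ge0 addrC -mulN1r -m_lin//.
apply: m_ge0 => [|x]; last by rewrite mulN1r addrC subr_ge0.
by apply: bounded_funD => //; exact: bounded_funZ.
Qed.

Lemma mean_sum (I : eqType) (r : seq I) (F : I -> T -> R) :
  (forall i, i \in r -> bounded_fun (F i)) ->
  bounded_fun (fun x => \sum_(i <- r) F i x) /\
  m (fun x => \sum_(i <- r) F i x) = \sum_(i <- r) m (F i).
Proof.
elim: r => [|i r IH] bF.
  rewrite (_ : (fun x => _) = fun=> 0); last first.
    by apply/funext => x; rewrite big_nil.
  by rewrite big_nil mean0; split=> //; exact: bounded_cst.
have [|b E] := IH; first by move=> j jr; apply: bF; rewrite in_cons jr orbT.
have bi : bounded_fun (F i) by apply: bF; rewrite mem_head.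
rewrite (_ : (fun x => \sum_(j <- i :: r) F j x) =
    fun x => F i x + \sum_(j <- r) F j x); last first.
  by apply/funext => x; rewrite big_cons.
by rewrite big_cons meanD// E; split=> //; exact: bounded_funD.
Qed.

(** Jensen's inequality for exp: take the mean of the tangent line bound at m f. *)
Lemma expR_mean_le f : bounded_fun f -> bounded_fun (fun x => expR (f x)) ->
  expR (m f) <= m (fun x => expR (f x)).
Proof.
move=> bf be; have bl : bounded_fun (fun x => f x + (1 - m f)).
  by apply: bounded_funD => //; exact: bounded_cst.
have <- : m (fun x => expR (m f) * (f x + (1 - m f))) = expR (m f).
  rewrite meanZ// meanD// ?mean_cst; last exact: bounded_cst.
  by rewrite addrC subrK mulr1.
apply: le_mean => // [|x]; first exact: bounded_funZ.
rewrite -[in leRHS](subrK (m f) (f x)) expRD mulrC ler_wpM2r ?expR_ge0//.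
by rewrite (le_trans _ (expR_ge1Dx _))//; lra.
Qed.

End Mean.

Section AmenableSubgroup.
Variables (R : realType) (G : groupType) (S : {fset G}) (H : chabauty G).
Hypotheses (S_sym : symmetric_set S) (genS : generating S).
Local Notation d := (#|` S|%:R : R).
Local Notation rmul := (fun g s : G => (g * s)%g).

Lemma exists_superharmonic_cayley (c : R) :
  (spectral_radius R (lnbr S rmul) < c%:E)%E ->
  exists2 v : G -> R, (forall x, 0 < v x) &
    forall x, nsum S rmul v x <= d * c * v x.
Proof.
apply: (@exists_superharmonic _ _ _ _ _ S_sym (fun s _ => @rmulK _ s) 1%g).
move=> Q Q1 QS.
by apply: (generating_ind S_sym genS Q1) => g s; exact: QS.
Qed.

Lemma exists_superharmonic_schreier (c : R) :
  (spectral_radius R (lnbr S (@coset_mul G H)) < c%:E)%E ->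
  exists2 v : coset_space H -> R, (forall x, 0 < v x) &
    forall x, nsum S (@coset_mul G H) v x <= d * c * v x.
Proof.
apply: (@exists_superharmonic _ _ _ _ _ S_sym (fun s _ => @coset_mulK _ H s)
  (coset_of H 1%g)) => Q Q1 QS x.
have [g <-] := coset_ofP x; move: g.
apply: (generating_ind S_sym genS) => // g s sS Qg.
by rewrite -coset_of_mul; exact: QS.
Qed.

(** The projection G -> H\G respects edge labels, so a superharmonic function on the Schreier graph
    lifts to one on G with the same c. *)
Lemma spectral_radius_cayley_le :
  (spectral_radius R (lnbr S rmul) <=
   spectral_radius R (lnbr S (@coset_mul G H)))%E.
Proof.
apply: (spectral_radius_le_gt S_sym) => [s _|s _|c c0 rho_c].
- exact: rmulK.
- exact: coset_mulK.
have [v v0 vc] := exists_superharmonic_schreier rho_c.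
pose V g := v (coset_of H g); have V0 g : 0 < V g by exact: v0.
apply: (spectral_radius_le_superharmonic S_sym (v := V)) => //.
  by move=> s _; exact: rmulK.
move=> g; apply: le_trans (vc _); rewrite /nsum.
by under [leRHS]eq_bigr do rewrite coset_of_mul.
Qed.

(* For v superharmonic on G, the weight of the edge from Hg to Hgs is the
   geometric mean over h in H of v(hgs) / v(hg); the mean being left invariant,
   it is taken along h |-> h^-1 g. *)
Lemma spectral_radius_schreier_le : amenable R (subgroup_type H) ->
  (spectral_radius R (lnbr S (@coset_mul G H)) <=
   spectral_radius R (lnbr S rmul))%E.
Proof.
move=> [m [m1 m_lin m_ge0 m_inv]].
apply: (spectral_radius_le_gt S_sym) => [s _|s _|c c0 rho_c].
- exact: coset_mulK.
- exact: rmulK.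
have [v v0 vc] := exists_superharmonic_cayley rho_c.
(* A Harnack inequality: it keeps the ratios r between (d c)^-1 and d c, so that the mean may be
   applied to r and to ln r. *)
have v_step g s : s \in S -> v (g * s)%g <= d * c * v g.
  move=> sS; apply: le_trans (vc g); rewrite /nsum (big_fsetD1 s)//= lerDl.
  by apply: sumr_ge0 => t _; exact: ltW.
pose r (g s : G) (h : subgroup_type H) : R :=
  v ((val h)^-1 * g * s)%g / v ((val h)^-1 * g)%g.
have r0 g s h : 0 < r g s h by rewrite divr_gt0.
have r_le g s h : s \in S -> r g s h <= d * c.
  by move=> sS; rewrite ler_pdivrMr// v_step.
have r_ge g s h : s \in S -> (d * c)^-1 <= r g s h.
  move=> sS; rewrite -[r _ _ _]invrK lef_pV2 ?posrE ?invr_gt0//; last first.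
    exact: lt_le_trans (r_le g s h sS).
  rewrite invf_div ler_pdivrMr//.
  by have := v_step ((val h)^-1 * g * s)%g _ (S_sym sS); rewrite mulgK.
have br g s : s \in S -> bounded_fun (r g s).
  move=> sS; apply/bounded_funP; exists (d * c) => h.
  by rewrite gtr0_norm// r_le.
have bl g s : s \in S -> bounded_fun (fun h => ln (r g s h)).
  move=> sS; apply/bounded_funP; exists (ln (d * c)) => h.
  have dc : 0 < d * c by exact: lt_le_trans (r_le g s h sS).
  rewrite ler_norml -lnV ?posrE// !ler_ln ?posrE ?invr_gt0//.
  by rewrite r_ge ?r_le.
pose L g s := m (fun h => ln (r g s h)).
(* Left invariance of the mean makes L a function of the coset Hg. *)
have LH h g s : s \in S -> subgroup_pred H h -> L (h * g)%g s = L g s.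
  move=> sS Hh; pose h' : subgroup_type H := Sub h Hh.
  rewrite /L -(m_inv h'^-1%g _ (bl g s sS)).
  congr m; apply/funext => k; rewrite /r /=.
  by rewrite /= !invgM !invgK !mulgA.
have LV g s : s \in S -> L (g * s)%g (s^-1)%g = - L g s.
  move=> sS; rewrite /L -mulN1r -(meanZ m_lin)//; last exact: bl.
  congr m; apply/funext => k; rewrite mulN1r -lnV ?posrE//; congr ln.
  by rewrite /r invf_div !mulgA mulgK.
(* By Jensen exp (L g s) is at most the mean of r, and the sum of r over s is at most d c
   pointwise. *)
have Lsum g : \sum_(s <- S) expR (L g s) <= d * c.
  have [] := mean_sum m_lin (r := S) (F := r g); first by move=> s; exact: br.
  move=> bs E; apply: (@le_trans _ _ (\sum_(s <- S) m (r g s))).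
    rewrite big_seq [leRHS]big_seq; apply: ler_sum => s sS.
    have -> : r g s = fun h => expR (ln (r g s h)).
      by apply/funext => h; rewrite lnK// posrE.
    apply: (expR_mean_le m1 m_lin m_ge0); first exact: bl.
    rewrite (_ : (fun _ => _) = r g s); first exact: br.
    by apply/funext => h; rewrite lnK// posrE.
  rewrite -E -[leRHS](mean_cst m1 m_lin); apply: (le_mean m_lin m_ge0) => //.
    exact: bounded_cst.
  by move=> h; rewrite -mulr_suml ler_pdivrMr//; exact: vc.
apply: (spectral_radius_le_quadratic S_sym) => // [s _|f ff f0].
  exact: coset_mulK.
pose k (x : coset_space H) (s : G) := expR (L (coset_rep x) s).
apply: le_trans (weighted_schur S_sym (fun s _ => @coset_mulK _ H s)
  (k := k) _ _ _ ff) => //.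
- rewrite lerDl mulr_ge0// tsum_ge0// => x; apply: sumr_ge0 => s _.
  by rewrite mulr_ge0 ?sqr_ge0// expR_ge0.
- by move=> x s _; exact: expR_gt0.
- move=> x s sS; rewrite /k -expRN -LV//; congr expR.
  (* The chosen representative of Hgs differs from that of Hg times s by an element of H, which [LH]
     absorbs. *)
  have /coset_eqP[h Hh ->] : coset_of H (coset_rep x * s)%g =
      coset_of H (coset_rep (coset_mul x s)).
    by rewrite coset_repK -coset_of_mul coset_repK.
  by rewrite LH//; exact: S_sym.
- by move=> x; exact: Lsum.
Qed.

End AmenableSubgroup.

(** * Almost invariant functions *)

(** Compactness of [-M, M] gives a cluster point, and an ultrafilter converges to its cluster
    points. *)
Lemma ultra_bounded_cvg (R : realType) (U : set_system nat) (x : nat -> R)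
    (M : R) :
  UltraFilter U -> (forall n, `|x n| <= M) -> cvg (x @ U).
Proof.
move=> UU xM; have cpt := @segment_compact R (- M) M.
have xU : (x @ U) [set` `[- M, M]].
  have UF : Filter U by exact: _.
  apply: (@filterE _ U _ (x @^-1` [set` `[- M, M]])) => n.
  by rewrite /= in_itv /= -ler_norml; exact: xM.
have [l [_ lU]] := cpt _ _ xU.
apply/cvg_ex; exists l => B Bl.
have [//|UC] := in_ultra_setVsetC (x @^-1` B) UU.
by have [y [yC yB]] := lU (~` B) B UC Bl.
Qed.

(** Passes from l^2 to l^1 almost invariance. In the factor 3, one part bounds the difference term,
    which is at most e c / 2, and two come from u^2 and its translate, each of total c. *)
Lemma tsum_sqr_variation (R : realType) (G : groupType) (u : G -> R) (t : G)
    (e : R) :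
  0 < e -> fin_supp u ->
  tsum (fun z => (u z - u (z * t)%g) ^+ 2) <=
    e ^+ 2 * tsum (fun z => u z ^+ 2) ->
  tsum (fun z => `|u z ^+ 2 - u (z * t)%g ^+ 2|) <=
    3 * e * tsum (fun z => u z ^+ 2).
Proof.
move=> e0 fu le; set c := tsum (fun z => u z ^+ 2) in le *.
have fut : fin_supp (fun z => u (z * t)%g).
  exact: fin_supp_shift.
have fuX : fin_supp (fun z => u z ^+ 2) by exact: fin_suppX.
have futX : fin_supp (fun z => u (z * t)%g ^+ 2) by exact: fin_suppX.
have fd : fin_supp (fun z => (u z - u (z * t)%g) ^+ 2).
  by apply/fin_suppX/fin_suppB.
have E : tsum (fun z => u (z * t)%g ^+ 2) = c.
  exact: (tsum_shift (fun z => u z ^+ 2)).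
have c0 : 0 <= c by apply: tsum_ge0 => z; exact: sqr_ge0.
apply: (@le_trans _ _ (tsum (fun z => (2 * e)^-1 * (u z - u (z * t)%g) ^+ 2 +
                                      e * (u z ^+ 2 + u (z * t)%g ^+ 2)))).
  apply: ler_tsum => [||z].
  - by apply/fin_supp_norm/fin_suppB.
  - by apply/fin_suppD; apply/fin_suppMl => //; exact: fin_suppD.
  - (* AM-GM: |(p - q) * (p + q)| <= (p - q) ^+ 2 / (2 * e) + e * (p + q) ^+ 2 / 2 *)
    move: (u z) (u (z * t)%g) => p q.
    have K : (2 * e) * (2 * e)^-1 = 1 by rewrite divff// mulf_neq0// gt_eqF.
    have := sqr_ge0 (p - q - e * (p + q)).
    have := sqr_ge0 (p - q + e * (p + q)).
    have := sqr_ge0 (p - q).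
    have i0 : 0 < (2 * e)^-1 by rewrite invr_gt0 mulr_gt0.
    move=> pq2 h1 h2; rewrite -(ler_pM2l (mulr_gt0 (ltr0n _ 2) e0)).
    rewrite mulrDr mulrA K mul1r.
    have s2 := mulr_ge0 (sqr_ge0 e) pq2.
    have [r0|r0] := leP 0 (p ^+ 2 - q ^+ 2).
      by rewrite ger0_norm//; lra.
    by rewrite ltr0_norm//; lra.
rewrite tsumD; [|by apply/fin_suppMl..|by apply/fin_suppMl/fin_suppD].
rewrite !tsumZ//; last exact: fin_suppD.
rewrite tsumD// E -/c.
have : (2 * e)^-1 * tsum (fun z => (u z - u (z * t)%g) ^+ 2) <= e * c.
  rewrite ler_pdivrMl ?mulr_gt0//; nra.
by lra.
Qed.

Lemma countable_cancel (G : groupType) : countable [set: G] ->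
  exists (j : G -> nat) (enumG : nat -> G), cancel j enumG.
Proof.
move=> /countable_injP[j j_inj].
exists j, (fun n => xget 1%g [set g | j g = n]) => g.
apply: j_inj; rewrite ?inE//.
by case: xgetP => [y _ //|/(_ g)[]].
Qed.

(** The normalised squares of almost invariant functions are almost invariant probability densities
    on G. Pushed to H, they have an invariant mean as ultralimit. *)
Lemma amenable_of_almost_invariant (R : realType) (G : groupType)
    (H : chabauty G) :
  countable [set: G] ->
  (forall (T : seq G) (e : R),
    (forall t, t \in T -> subgroup_pred H t) -> 0 < e ->
    exists2 u : G -> R, fin_supp u &
      \sum_(t <- T) tsum (fun z => (u z - u (z * t)%g) ^+ 2) <
        e * tsum (fun z => u z ^+ 2)) ->
  amenable R (subgroup_type H).
Proof.
move=> /countable_cancel[j [enumG enumK]] almost_inv.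
(* The sets [T n] exhaust H, so each element of H is eventually tested, with tolerance [e n] tending
   to 0. *)
pose T n : seq G :=
  [seq t <- [seq enumG i | i <- iota 0 n] | subgroup_pred H t].
have TP n h : subgroup_pred H h -> (j h < n)%N -> h \in T n.
  move=> Hh jn; rewrite mem_filter Hh/=; apply/mapP.
  by exists (j h); rewrite ?enumK// mem_iota.
pose e n : R := n.+1%:R^-1.
have e0 n : 0 < e n by rewrite invr_gt0.
have [u uP] : {u : nat -> G -> R & forall n, fin_supp (u n) /\
    \sum_(t <- T n) tsum (fun z => (u n z - u n (z * t)%g) ^+ 2) <
        e n ^+ 2 * tsum (fun z => u n z ^+ 2)}.
  apply: (@choice _ _ (fun n v => fin_supp v /\
    \sum_(t <- T n) tsum (fun z => (v z - v (z * t)%g) ^+ 2) <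
        e n ^+ 2 * tsum (fun z => v z ^+ 2))) => n.
  have [|v fv lt] := almost_inv (T n) (e n ^+ 2) _ (exprn_gt0 2 (e0 n)).
    by move=> t; rewrite mem_filter => /andP[].
  by exists v.
have fu n : fin_supp (u n) by have [] := uP n.
pose c n := tsum (fun z => u n z ^+ 2).
have c0 n : 0 < c n.
  have [_ lt] := uP n; rewrite -(pmulr_rgt0 _ (exprn_gt0 2 (e0 n))).
  apply: le_lt_trans lt; apply: sumr_ge0 => t _; apply: tsum_ge0 => z.
  exact: sqr_ge0.
pose p n z := (c n)^-1 * u n z ^+ 2.
have p0 n z : 0 <= p n z by rewrite mulr_ge0 ?sqr_ge0// invr_ge0 ltW.
have fuX n : fin_supp (fun z => u n z ^+ 2) by exact: fin_suppX.
have fp n : fin_supp (p n) by exact: fin_suppMl.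
have p1 n : tsum (p n) = 1 by rewrite tsumZ// mulVf// gt_eqF.
have p_shift n t : subgroup_pred H t -> (j t < n)%N ->
    tsum (fun z => `|p n z - p n (z * t)%g|) <= 3 * e n.
  move=> Ht jt; have tT := TP n t Ht jt; have [_ lt] := uP n.
  have : tsum (fun z => (u n z - u n (z * t)%g) ^+ 2) <= e n ^+ 2 * c n.
    apply: le_trans (ltW lt); rewrite (big_rem _ tT)/= lerDl.
    apply: sumr_ge0 => s _; apply: tsum_ge0 => z; exact: sqr_ge0.
  move=> /(tsum_sqr_variation (e0 n) (fu n)).
  have -> : (fun z => `|p n z - p n (z * t)%g|) =
      fun z => (c n)^-1 * `|u n z ^+ 2 - u n (z * t)%g ^+ 2|.
    apply/funext => z; rewrite /p -mulrBr normrM ger0_norm//.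
    by rewrite invr_ge0 ltW.
  rewrite tsumZ ?ler_pdivrMl// 1?[c n * _]mulrC//.
  apply/fin_supp_norm/fin_suppB => //.
  exact: fin_supp_shift (fuX n).
(* A transversal r of the left cosets of H gives an H-equivariant map
   q : G -> H, along which functions on H are pulled back to G. *)
pose r z := xget 1%g [set y | subgroup_pred H (z^-1 * y)%g].
have rP z : subgroup_pred H (z^-1 * r z)%g.
  apply: (@xgetPex _ 1%g [set y | subgroup_pred H (z^-1 * y)%g]).
  by exists z; rewrite /= mulVg; exact: subgroup1.
have r_mul z h : subgroup_pred H h -> r (z * h)%g = r z.
  move=> Hh; congr xget; apply/seteqP; split=> y /= Hy.
    have := subgroupM Hh Hy; rewrite invgM -!mulgA mulVKg; exact.
  by rewrite invgM -mulgA; apply: subgroupM => //; exact: subgroupV.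
pose q z : subgroup_type H := Sub (z^-1 * r z)%g (rP z).
have q_mul z (h : subgroup_type H) : q (z * val h)%g = (h^-1 * q z)%g.
  by apply: val_inj; rewrite /= r_mul ?invgM ?mulgA//; exact: valP.
have [U [UU UN]] := ultraFilterLemma eventually_filter.
pose x (f : subgroup_type H -> R) n := tsum (fun z => p n z * f (q z)).
pose m f : R := lim (x f @ U).
have fpf f n : fin_supp (fun z => p n z * f (q z)) by exact: fin_suppMr.
have x_le f M n : (forall h, `|f h| <= M) -> `|x f n| <= M.
  move=> fM; apply: (le_trans (ler_norm_tsum (fpf f n))).
  rewrite -[M]mulr1 -(p1 n) -tsumZ//; apply: ler_tsum => [||z].
  - exact: fin_supp_norm.
  - exact: fin_suppMl.
  - by rewrite normrM (ger0_norm (p0 n z)) mulrC ler_wpM2r.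
have x_cvg f : bounded_fun f -> x f @ U --> m f.
  move=> /bounded_funP[M fM]; apply: (@ultra_bounded_cvg _ _ _ M) => n.
  exact: x_le.
exists m; split.
- rewrite /m (_ : x _ = cst 1); first exact: lim_cst.
  apply/funext => n; rewrite /x -[RHS](p1 n).
  by congr tsum; apply/funext => z; rewrite mulr1.
- move=> a f g bf bg; apply/cvg_lim => //.
  rewrite (_ : x _ = fun n => a * x f n + x g n).
    by apply: cvgD; [apply: cvgMr; exact: x_cvg|exact: x_cvg].
  apply/funext => n; rewrite /x -tsumZ// -tsumD//; last exact: fin_suppMl.
  by congr tsum; apply/funext => z; rewrite mulrDr mulrCA.
- move=> f bf f0; apply: limr_ge; first exact: x_cvg.
  by apply: nearW => n; apply: tsum_ge0 => z; rewrite mulr_ge0.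
- move=> a f bf; apply/cvg_lim => //.
  (* Substituting z a for z moves the translation from f to the density, since a q(z a) = q z. *)
  have xE n : x (fun h => f (a * h)%g) n - x f n =
      tsum (fun z => (p n (z * val a)%g - p n z) * f (q z)).
    rewrite /x -(tsum_shift (fun z => p n z * f (a * q z)%g) (val a)).
    rewrite -tsumB//; last by apply: fin_suppMr; exact: fin_supp_shift (fp n).
    by congr tsum; apply/funext => z; rewrite q_mul mulVKg mulrBl.
  have : (fun n => x (fun h => f (a * h)%g) n - x f n) @ U --> (0 : R).
    have /bounded_funP[M fM] := bf.
    apply: (@cvg_trans _ ((fun n => x (fun h => f (a * h)%g) n - x f n) @ \oo)).
      by move=> A /= ?; exact: UN.
    apply: norm_cvg0.
    apply: (@squeeze_cvgr _ _ _ _ (fun=> 0) (fun n => 3 * M * e n)).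
    + near=> n; rewrite normr_ge0/= xE.
      have jn : (j (val a) < n)%N by near: n; exists (j (val a)).+1.
      have fd : fin_supp (fun z => p n z - p n (z * val a)%g).
        apply: fin_suppB => //.
        exact: fin_supp_shift (fp n).
      have M0 : 0 <= M by exact: le_trans (fM 1%g).
      apply: (@le_trans _ _ (tsum (fun z => M * `|p n z - p n (z * val a)%g|))).
        have fd' : fin_supp (fun z => (p n (z * val a)%g - p n z) * f (q z)).
          apply: fin_suppMr; apply: fin_supp_le fd => z /eqP.
          by rewrite subr_eq0 => /eqP ->; rewrite subrr.
        apply: (le_trans (ler_norm_tsum fd')); apply: ler_tsum => [||z].
        * exact: fin_supp_norm.
        * by apply/fin_suppMl/fin_supp_norm.
        * by rewrite normrM mulrC distrC ler_wpM2r.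
      rewrite tsumZ; last exact: fin_supp_norm.
      by rewrite -mulrA mulrCA ler_wpM2l// p_shift//; exact: valP.
    + exact: cvg_cst.
    + rewrite -[0](mulr0 (3 * M)); apply: cvgMr; exact: cvg_harmonic.
  move=> /(cvgD (x_cvg f bf)); rewrite addr0; apply: cvg_trans.
  apply: near_eq_cvg; apply: nearW => n; rewrite /= addrC subrK.
Unshelve. all: by end_near. Qed.

(** * Uniform recurrence *)

Section ChabautyTopology.
Variable G : groupType.
Implicit Types (H K : chabauty G) (g h t : G).

Lemma mem_conj_subgroup H g h :
  subgroup_pred (conj_subgroup H g) h = subgroup_pred H (g * h * g^-1)%g.
Proof.
transitivity (subgroup_pred H (h ^ g^-1)%g) => //.
by rewrite conjgE invgK mulgA.
Qed.

Lemma nbhs_subgroup_mem H h : subgroup_pred H h ->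
  nbhs H [set K : chabauty G | subgroup_pred K h].
Proof.
move=> Hh; have ev : continuous (fun K : chabauty G => subgroup_pred K h).
  move=> K; apply: (@continuous_comp _ _ _
    (set_val : chabauty G -> {ptws G -> bool})
    (fun f : {ptws G -> bool} => f h)).
    exact: initial_continuous.
  exact: (@proj_continuous G (fun=> bool) h).
have : nbhs (subgroup_pred H h) [set true] by rewrite Hh; exact: discrete_set1.
by move=> /ev evH; apply: (@filterS _ (nbhs H) _ _ _ _ evH) => K.
Qed.

(** In the product topology convergence is coordinatewise, and each coordinate lies in a discrete
    space. *)
Lemma cvg_chabauty (F : set_system (chabauty G)) K : Filter F ->
  (forall h, F [set L | subgroup_pred L h = subgroup_pred K h]) -> F --> K.
Proof.
move=> FF FK B [_ [[W oW <-] WK] WB]; apply: filterS WB _.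
have FW : (set_val @ F) --> (set_val K : {ptws G -> bool}).
  apply/cvg_sup => h; move=> C [_ [[D oD <-] DK] DC].
  apply: filterS DC _; rewrite /= /nbhs /=.
  apply: filterS (FK h) => L /= E.
  by rewrite /= -[set_val L h]/(subgroup_pred L h) E.
by apply: FW; apply: open_nbhs_nbhs; split.
Qed.

(* Otherwise an ultralimit of conjugates of H would be a point of the orbit
   closure none of whose conjugates contains T, so that H could not be in the
   closure of its orbit. *)
Lemma uniformly_recurrent_syndetic H (T : seq G) : countable [set: G] ->
  uniformly_recurrent H -> (forall t, t \in T -> subgroup_pred H t) ->
  exists F : seq G, forall g, exists2 f, f \in F &
    forall t, t \in T -> subgroup_pred H (g * f * t * f^-1 * g^-1)%g.
Proof.
move=> /countable_cancel[j [enumG enumK]] urs HT; apply: contrapT => noF.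
(* [u n] witnesses that the first n elements of G do not suffice as F. *)
have [u uP] : {u : nat -> G & forall n i, (i < n)%N -> exists2 t, t \in T &
    ~ subgroup_pred H (u n * enumG i * t * (enumG i)^-1 * (u n)^-1)%g}.
  apply: (@choice _ _ (fun n g => forall i, (i < n)%N -> exists2 t, t \in T &
    ~ subgroup_pred H (g * enumG i * t * (enumG i)^-1 * g^-1)%g)) => n.
  apply: contrapT => nog; apply: noF; exists [seq enumG i | i <- iota 0 n] => g.
  apply: contrapT => nof; apply: nog; exists g => i ilt.
  apply: contrapT => noT; apply: nof; exists (enumG i).
    by apply/mapP; exists i => //; rewrite mem_iota.
  by move=> t tT; apply: contrapT => Ht; apply: noT; exists t.
have [U [UU UN]] := ultraFilterLemma eventually_filter.
pose inK h : set nat := [set n | subgroup_pred H (u n * h * (u n)^-1)%g].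
pose K0 : {ptws G -> bool} := fun h => `[< U (inK h) >].
have K0g : group_closed (K0 : {pred G}).
  split=> [|g h /asboolP Ug /asboolP Uh]; apply/asboolP.
    by apply: filterE => n; rewrite /inK /= mulg1 mulgV; exact: subgroup1.
  move: Ug Uh; apply: filterS2 => n; rewrite /inK /= => Hg Hh.
  have := subgroupM Hg (subgroupV Hh).
  by rewrite !invgM invgK !mulgA mulgVK.
pose K : chabauty G := exist _ K0 (mem_set K0g).
have cvgK : (conj_subgroup H \o u) @ U --> K.
  apply: cvg_chabauty => h; rewrite /nbhs /=.
  have [Uh|nUh] := pselect (U (inK h)).
    move: (Uh); apply: filterS => n /= Hn; rewrite mem_conj_subgroup Hn.
    exact/esym/asboolP.
  have [//|UC] := in_ultra_setVsetC (inK h) UU.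
  move: UC; apply: filterS => n /= /negP/negbTE Hn.
  rewrite mem_conj_subgroup Hn.
  exact/esym/asboolP.
have XK : closure (conjugates H) K.
  move=> B /cvgK UB; have [n Bn] := @filter_ex _ U _ _ UB.
  by exists (conj_subgroup H (u n)); split => //; exists (u n).
have XH : closure (conjugates H) H.
  apply: subset_closure; exists 1%g => //; apply/val_inj/funext => h.
  by rewrite -[LHS]/(subgroup_pred (conj_subgroup H 1%g) h) mem_conj_subgroup
    invg1 mulg1 mul1g.
have nT : nbhs H [set L : chabauty G | forall t, t \in T -> subgroup_pred L t].
  elim: T HT {noF uP} => [|t T IH] HT; first by apply: filterE.
  have /IH nT : forall s, s \in T -> subgroup_pred H s.
    by move=> s sT; apply: HT; rewrite in_cons sT orbT.
  have := nbhs_subgroup_mem (HT t (mem_head _ _)).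
  apply: filterS2 nT => L LT Lt s; rewrite in_cons => /orP[/eqP ->//|].
  exact: LT.
(* Minimality: H is in the orbit closure of the ultralimit K, and containing T is an open condition,
   so some conjugate of K contains T. For U-many n this contradicts the choice of [u n] once f is
   among the first n elements. *)
have [_ [[f _ <-] KT]] := urs K XK H XH _ nT.
have UT : U [set n | forall t, t \in T ->
    subgroup_pred H (u n * f * t * f^-1 * (u n)^-1)%g].
  elim: T KT {HT noF uP nT} => [|t T IH] KT; first by apply: filterE.
  have /IH UT : forall s, s \in T -> subgroup_pred (conj_subgroup K f) s.
    by move=> s sT; apply: KT; rewrite in_cons sT orbT.
  have := KT t (mem_head _ _); rewrite mem_conj_subgroup => /asboolP.
  apply: filterS2 UT => n LT; rewrite /inK /= !mulgA => Lt s.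
  by rewrite in_cons => /orP[/eqP ->//|]; exact: LT.
have Uj : U [set n | (j f < n)%N] by apply: UN; exists (j f).+1.
have [n [nT' nj]] := @filter_ex _ U _ _ (filterI UT Uj).
have [t tT] := uP n (j f) nj; rewrite enumK; apply.
exact: nT'.
Qed.

End ChabautyTopology.

(** * The spectral gap *)

Section PathEnergy.
Variables (R : realType) (G : groupType) (S : {fset G}).
Hypotheses (S_sym : symmetric_set S) (genS : generating S).
Implicit Types (v w f : G -> R) (g s t : G).

(** The Dirichlet form with conductances v(g) v(gs). At w = f / v it is the energy term of
    [weighted_schur]. *)
Definition edge_energy v w :=
  tsum (fun g => \sum_(s <- S) v g * v (g * s)%g * (w g - w (g * s)%g) ^+ 2).

(** For w = f / v, a term with v(gt) = v(g) equals (f(g) - f(gt))^2. *)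
Definition shift_energy v w t :=
  tsum (fun g => v g ^+ 2 * (w g - w (g * t)%g) ^+ 2).

Lemma fin_supp_diff w t : fin_supp w ->
  fin_supp (fun g => (w g - w (g * t)%g) ^+ 2).
Proof.
by move=> fw; apply/fin_suppX/fin_suppB => //; exact: fin_supp_shift.
Qed.

Lemma edge_energy_ge0 v w : (forall g, 0 < v g) -> 0 <= edge_energy v w.
Proof.
move=> v0; apply: tsum_ge0 => g; apply: sumr_ge0 => s _.
by apply: mulr_ge0 (sqr_ge0 _); apply: mulr_ge0; exact: ltW.
Qed.

(** One edge is kept from the Dirichlet form, and v(g) <= C v(gs) turns v(g)^2 into C v(g) v(gs). *)
Lemma shift_energy_generator (C : R) v w s : s \in S -> 0 <= C ->
  (forall g, 0 < v g) ->
  (forall g r, r \in S -> v (g * r)%g <= C * v g) -> fin_supp w ->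
  shift_energy v w s <= C * edge_energy v w.
Proof.
move=> sS C0 v0 vC fw.
have fE : fin_supp (fun g =>
    \sum_(r <- S) v g * v (g * r)%g * (w g - w (g * r)%g) ^+ 2).
  by apply: fin_supp_sum => r _; apply/fin_suppMl/fin_supp_diff.
rewrite -tsumZ//; apply: ler_tsum => [||g].
- by apply/fin_suppMl/fin_supp_diff.
- exact: fin_suppMl.
rewrite (big_fsetD1 _ sS)/= mulrDr -[leLHS]addr0 lerD//; last first.
  rewrite mulr_ge0//; apply: sumr_ge0 => r _.
  by apply: mulr_ge0 (sqr_ge0 _); apply: mulr_ge0; exact: ltW.
have := vC (g * s)%g _ (S_sym sS); rewrite mulgK => vgs.
rewrite mulrA ler_wpM2r ?sqr_ge0// mulrCA expr2 ler_wpM2l//.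
exact: ltW.
Qed.

(** Induction along a word for t. The constant K is chosen before v and w, which later gives a gap
    uniform in c. *)
Lemma shift_energy_le (C : R) t : 0 <= C ->
  exists K : R, 0 <= K /\ forall v w, (forall g, 0 < v g) ->
    (forall g s, s \in S -> v (g * s)%g <= C * v g) -> fin_supp w ->
    shift_energy v w t <= K * edge_energy v w.
Proof.
move=> C0.
(* The induction also carries a Harnack constant L along t, to move the weight from g to gt before
   the next edge is added. *)
suff [K [L [K0 L0 KL]]] : exists K L : R, [/\ 0 <= K, 0 <= L &
    forall v w, (forall g, 0 < v g) ->
    (forall g s, s \in S -> v (g * s)%g <= C * v g) -> fin_supp w ->
    shift_energy v w t <= K * edge_energy v w /\
    forall g, v g <= L * v (g * t)%g].
  by exists K; split=> // v w v0 vC fw; have [] := KL v w v0 vC fw.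
move: t; apply: (generating_ind S_sym genS) => [|t s sS [K [L [K0 L0 KL]]]].
  exists 0, 1; split=> // v w v0 vC fw.
  split=> [|g]; last by rewrite mulg1 mul1r.
  rewrite mul0r /shift_energy (_ : (fun _ => _) = fun=> 0) ?tsum0//.
  by apply/funext => g; rewrite mulg1 subrr expr0n mulr0.
(* From (a - c)^2 <= 2 (a - b)^2 + 2 (b - c)^2 along g, gt, gts: the first part costs K, the last
   edge C, and its change of weight L^2. *)
exists (2 * K + 2 * (L ^+ 2 * C)), (L * C).
have LC0 : 0 <= L ^+ 2 * C by rewrite mulr_ge0// sqr_ge0.
split=> [||v w v0 vC fw]; [by lra|exact: mulr_ge0|].
have [Dt vL] := KL v w v0 vC fw.
have v_back g : v g <= C * v (g * s)%g.
  by have := vC (g * s)%g _ (S_sym sS); rewrite mulgK.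
split=> [|g]; last first.
  apply: le_trans (vL g) _; rewrite -mulrA ler_wpM2l// mulgA; exact: v_back.
have Ds := shift_energy_generator sS C0 v0 vC fw.
pose F g := v g ^+ 2 * (w g - w (g * s)%g) ^+ 2.
have fF : fin_supp F by apply/fin_suppMl/fin_supp_diff.
have fFt : fin_supp (fun g => F (g * t)%g) by exact: fin_supp_shift.
have fD : fin_supp (fun g => v g ^+ 2 * (w g - w (g * t)%g) ^+ 2).
  by apply/fin_suppMl/fin_supp_diff.
apply: (@le_trans _ _ (2 * shift_energy v w t + 2 * (L ^+ 2 * tsum F)));
  last first.
  have := ler_wpM2l (sqr_ge0 L) (Ds : tsum F <= _); lra.
rewrite -(tsum_shift F t) -!tsumZ//; last exact: fin_suppMl.
rewrite -tsumD; last 2 first.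
- exact: fin_suppMl.
- by apply/fin_suppMl/fin_suppMl.
apply: ler_tsum => [||g].
- by apply/fin_suppMl/fin_supp_diff.
- by apply: fin_suppD; apply: fin_suppMl => //; exact: fin_suppMl.
rewrite /F mulgA; set a := w g; set b := w (g * t)%g; set c := w (g * t * s)%g.
have v2 : v g ^+ 2 <= L ^+ 2 * v (g * t)%g ^+ 2.
  by rewrite -exprMn lerXn2r ?nnegrE ?mulr_ge0// ltW.
have := ler_wpM2r (sqr_ge0 (b - c)) v2.
have := mulr_ge0 (sqr_ge0 (v g)) (sqr_ge0 (a - b - (b - c))).
lra.
Qed.

End PathEnergy.

Section SpectralGap.
Variables (R : realType) (G : groupType) (S : {fset G}) (H : chabauty G).
Hypotheses (S_sym : symmetric_set S) (genS : generating S).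
Local Notation d := (#|` S|%:R : R).
Local Notation rmul := (fun g s : G => (g * s)%g).

(* G is split into H-invariant pieces according to the i in F selected at the
   coset Hg. On such a piece i T i^-1 preserves cosets, so v is constant along
   the shifts, and the inequality for T, translated by i, applies to f. *)
Lemma sum_shift_energy_ge (T F : seq G) (e : R) (v f : G -> R) :
  (forall u : G -> R, fin_supp u ->
    e * tsum (fun z => u z ^+ 2) <=
      \sum_(t <- T) tsum (fun z => (u z - u (z * t)%g) ^+ 2)) ->
  (forall g, exists2 i, i \in F & forall t, t \in T ->
    subgroup_pred H (g * i * t * i^-1 * g^-1)%g) ->
  0 <= e -> (forall g, 0 < v g) ->
  (forall h g, subgroup_pred H h -> v (h * g)%g = v g) -> fin_supp f ->
  e * tsum (fun g => f g ^+ 2) <=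
    \sum_(i <- F) \sum_(t <- T)
      shift_energy v (fun g => f g / v g) (i * t * i^-1)%g.
Proof.
move=> Te FT e0 v0 vH ff.
have [i iP] : {i : coset_space H -> G & forall x, i x \in F /\
    forall t, t \in T ->
    subgroup_pred H (coset_rep x * i x * t * (i x)^-1 * (coset_rep x)^-1)%g}.
  apply: (@choice _ _ (fun x j => j \in F /\ forall t, t \in T ->
    subgroup_pred H (coset_rep x * j * t * j^-1 * (coset_rep x)^-1)%g)) => x.
  by have [j jF jT] := FT (coset_rep x); exists j.
pose k g := i (coset_of H g).
have kF g : k g \in F by have [] := iP (coset_of H g).
have kT g t : t \in T -> subgroup_pred H (g * k g * t * (k g)^-1 * g^-1)%g.
  move=> tT; have [_ /(_ t tT) Ht] := iP (coset_of H g).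
  have /coset_eqP[h Hh E] := coset_repK (coset_of H g).
  rewrite -/(k g) in Ht; move: (k g) (coset_rep _) Ht E => a r Ht ->.
  have := subgroupM (subgroupM Hh Ht) (subgroupV Hh).
  by rewrite invgM !mulgA.
have k_shift g t : t \in T ->
    coset_of H (g * (k g * t * (k g)^-1))%g = coset_of H g.
  move=> tT; apply/esym/coset_eqP; exists (g * k g * t * (k g)^-1 * g^-1)%g.
    exact: kT.
  by rewrite !mulgA mulgVK.
pose u j g := if k g == j then f g else 0.
have fu j : fin_supp (u j).
  by apply: fin_supp_le ff => g fg; rewrite /u fg if_same.
have fu2 j : fin_supp (fun g => u j g ^+ 2) by exact: fin_suppX.
have fw : fin_supp (fun g => f g / v g) by exact: fin_suppMr.
(* Every g lies in the piece of some j in F; possible repetitions in F only enlarge the sum. *)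
apply: (@le_trans _ _ (\sum_(j <- F) e * tsum (fun g => u j g ^+ 2))).
  rewrite -mulr_sumr ler_wpM2l// -tsum_sum//.
  apply: ler_tsum => [||g]; [exact: fin_suppX|exact: fin_supp_sum|].
  rewrite (big_rem _ (kF g))/= /u eqxx lerDl.
  by apply: sumr_ge0 => j _; exact: sqr_ge0.
apply: ler_sum => j _.
have fuj : fin_supp (fun z => u j (z * j^-1)%g) by exact: fin_supp_shift.
have := Te _ fuj.
rewrite (tsum_shift (fun z => u j z ^+ 2)) => /le_trans; apply.
rewrite big_seq [leRHS]big_seq; apply: ler_sum => t tT.
rewrite -(tsum_shift _ j).
apply: ler_tsum => [||g].
- exact: (fin_supp_shift j (fin_supp_diff t fuj)).
- by apply/fin_suppMl/fin_supp_diff.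
rewrite mulgK !mulgA.
set g' := (g * j * t * j^-1)%g.
have [coset_g'|coset_g'] := pselect (coset_of H g' = coset_of H g).
  have vg' : v g' = v g.
    by move/esym/coset_eqP : coset_g' => [h Hh ->]; exact: vH.
  rewrite /u /k coset_g'; case: ifP => _; last first.
    by rewrite subrr expr0n mulr_ge0 ?sqr_ge0//.
  by rewrite vg' -mulrBl -exprMn mulrC divfK// gt_eqF.
(* If the shift leaves the coset Hg, neither end lies in the piece of j, because j T j^-1 preserves
   the cosets there; so u j vanishes at both ends. *)
have nk : k g != j.
  apply: contra_notN coset_g' => /eqP jE.
  by rewrite -(k_shift g t tT) jE /g' !mulgA.
have nk' : k g' != j.
  apply: contra_notN coset_g' => /eqP jE.
  have tV : subgroup_pred H (g * g'^-1)%g.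
    have := subgroupV (kT g' t tT); rewrite jE.
    have -> : (g' * j * t * j^-1 * g'^-1)%g = (g' * g^-1)%g.
      rewrite {2}/g' !invgM !invgK !mulgA.
      by rewrite (mulgVK j) (mulgK t) (mulgK j).
    by rewrite invgM invgK.
  by apply/coset_eqP; exists (g * g'^-1)%g; rewrite ?mulgVK.
rewrite /u (negbTE nk) (negbTE nk') subrr expr0n mulr_ge0 ?sqr_ge0//.
Qed.

(** The gap delta depends on c only through the upper bound c0, so c may approach the spectral
    radius of the Schreier graph without losing it. *)
Lemma quadratic_gap (T F : seq G) (e : R) : 0 < e ->
  (forall u : G -> R, fin_supp u ->
    e * tsum (fun z => u z ^+ 2) <=
      \sum_(t <- T) tsum (fun z => (u z - u (z * t)%g) ^+ 2)) ->
  (forall g, exists2 i, i \in F & forall t, t \in T ->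
    subgroup_pred H (g * i * t * i^-1 * g^-1)%g) ->
  forall c0 : R, exists2 delta : R, 0 < delta & forall c, 0 < c -> c <= c0 ->
    (spectral_radius R (lnbr S (@coset_mul G H)) < c%:E)%E ->
    forall f : G -> R, fin_supp f ->
    tsum (fun g => f g * nsum S rmul f g) + delta * tsum (fun g => f g ^+ 2) <=
      d * c * tsum (fun g => f g ^+ 2).
Proof.
move=> e0 Te FT c0.
pose C : R := d * `|c0|; have C0 : 0 <= C by rewrite mulr_ge0.
have [K KP] := choice (fun t => shift_energy_le S_sym genS t C0).
have K0 t : 0 <= K t by have [] := KP t.
pose Kt : R := \sum_(i <- F) \sum_(t <- T) K (i * t * i^-1)%g.
have Kt0 : 0 <= Kt by apply: sumr_ge0 => i _; apply: sumr_ge0.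
(* The half comes from [weighted_schur], [Kt] adds up the constants of all shifts, and the 1 keeps
   the denominator positive. *)
exists (2^-1 * (e / (Kt + 1))).
  by rewrite mulr_gt0 ?invr_gt0// divr_gt0// ltr_wpDl.
move=> c c_gt0 cc0 rho_c f ff.
have [v v0 vc] := exists_superharmonic_schreier S_sym genS rho_c.
pose V g := v (coset_of H g).
have V0 g : 0 < V g by exact: v0.
have VN g : \sum_(s <- S) V (g * s)%g <= d * c * V g.
  apply: le_trans (vc _); rewrite /nsum.
  by under [leRHS]eq_bigr do rewrite coset_of_mul.
have VC g s : s \in S -> V (g * s)%g <= C * V g.
  move=> sS; apply: (@le_trans _ _ (d * c * V g)).
    apply: le_trans (VN g); rewrite (big_fsetD1 s)//= lerDl.
    by apply: sumr_ge0 => t _; exact: ltW.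
  apply: ler_wpM2r; first exact: ltW.
  by apply: ler_wpM2l => //; exact: le_trans (ler_norm _).
have VH h g : subgroup_pred H h -> V (h * g)%g = V g.
  by move=> Hh; congr v; apply/esym/coset_eqP; exists h.
pose w g := f g / V g; have fw : fin_supp w by exact: fin_suppMr.
pose E := edge_energy S V w; have E0 : 0 <= E by exact: edge_energy_ge0.
have fE : e / (Kt + 1) * tsum (fun g => f g ^+ 2) <= E.
  rewrite mulrAC ler_pdivrMr; last by rewrite ltr_wpDl.
  apply: le_trans (sum_shift_energy_ge Te FT (ltW e0) V0 VH ff) _.
  apply: (@le_trans _ _ (Kt * E)); last by rewrite mulrC ler_wpM2l// lerDl.
  rewrite mulr_suml; apply: ler_sum => i _.
  rewrite mulr_suml; apply: ler_sum => t _.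
  by have [_ /(_ V w V0 VC fw)] := KP (i * t * i^-1)%g.
pose k g s := V (g * s)%g / V g.
have := weighted_schur S_sym (fun s _ => @rmulK G s) (k := k) (c := c) _ _ _ ff.
rewrite (_ : tsum (fun x => \sum_(s <- S) _) = E).
  move=> Schur; have {Schur} := Schur.
  set Q := tsum _; set n := tsum _ => Schur.
  have : Q + 2^-1 * E <= d * c * n.
    apply: Schur => [g s _|g s _|g]; first exact: divr_gt0.
      by rewrite /k mulgK invf_div.
    by rewrite -mulr_suml ler_pdivrMr.
  by rewrite -/n in fE *; lra.
(* With w = f / V, the defect k (f(g) - k^-1 f(gs))^2 is V(g) V(gs) (w(g) - w(gs))^2. *)
congr tsum; apply/funext => g; apply: eq_bigr => s _.
rewrite /k /w invf_div.
have := V0 g; have := V0 (g * s)%g; move: (V g) (V (g * s)%g) => a b b0 a0.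
move: (f g) (f (g * s)%g) => p q.
have aK : a * a^-1 = 1 by rewrite divff// gt_eqF.
have bK : b * b^-1 = 1 by rewrite divff// gt_eqF.
move: a^-1 b^-1 aK bK => a' b' aK bK.
have -> : p - a * b' * q = a * (p * a' - q * b').
  by rewrite mulrBr mulrCA aK mulr1 [q * _]mulrC mulrA.
set X := _ - q * b'.
have -> : b * a' * (a * X) ^+ 2 = a * a' * (a * b * X ^+ 2) by lra.
by rewrite aK mul1r.
Qed.

End SpectralGap.

Theorem theorem1p4 (R : realType) (G : groupType) (S : {fset G})
    (H : chabauty G) (hG : countable [set: G]) (hS : symmetric_set S)
    (hgen : generating S) (hH : uniformly_recurrent H) :
  amenable R (subgroup_type H) <->
  spectral_radius R (cayley_nbr S) = spectral_radius R (schreier_nbr S (H := H)).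
Proof.
rewrite -[cayley_nbr S]/(lnbr S (fun g s : G => (g * s)%g)).
rewrite -[schreier_nbr S (H := H)]/(lnbr S (@coset_mul G H)).
set rG := spectral_radius R (lnbr S (fun g s : G => (g * s)%g)).
set rH := spectral_radius R (lnbr S (@coset_mul G H)).
split=> [amH|rGH].
  apply/eqP; rewrite eq_le spectral_radius_cayley_le//.
  exact: spectral_radius_schreier_le.
apply: contrapT => namH.
have [T [e [HT e0 Te]]] : exists (T : seq G) (e : R),
    [/\ forall t, t \in T -> subgroup_pred H t, 0 < e &
    forall u : G -> R, fin_supp u -> e * tsum (fun z => u z ^+ 2) <=
      \sum_(t <- T) tsum (fun z => (u z - u (z * t)%g) ^+ 2)].
  apply: contrapT => noT; apply: namH.
  apply: (amenable_of_almost_invariant hG) => T e HT e0.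
  apply: contrapT => nou; apply: noT; exists T, e; split=> // u fu.
  by rewrite leNgt; apply/negP => lt; apply: nou; exists u.
have [F FT] := uniformly_recurrent_syndetic hG hH HT.
have rHF : rH \is a fin_num.
  by apply: (spectral_radius_fin_num R hS) => s _; exact: coset_mulK.
pose rho := fine rH.
have rhoE : rH = rho%:E by rewrite fineK.
have rho0 : 0 <= rho by rewrite fine_ge0// spectral_radius_ge0.
(* If S were empty, G would be trivial and all shift differences zero, against [Te] at the indicator
   of 1. *)
have d0 : 0 < (#|` S|%:R : R).
  rewrite ltr0n cardfs_gt0; apply/negP => /eqP S0.
  have triv (g : G) : g = 1%g.
    by move: g; apply: (generating_ind hS hgen) => // g s; rewrite S0.
  have := Te _ (fin_supp_delta (1%g : G) (1 : R)).
  rewrite big1 => [|t _].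
    rewrite leNgt mulr_gt0//.
    rewrite (_ : (fun _ => _) = (fun x : G => if x == 1%g then 1 else 0)).
      by rewrite tsum_delta.
    by apply/funext => z; case: ifP; rewrite ?expr1n ?expr0n.
  rewrite (_ : (fun _ => _) = fun=> 0) ?tsum0//; apply/funext => z.
  by rewrite (triv z) (triv (_ * t)%g) subrr expr0n.
have [delta delta0 gap] := quadratic_gap hS hgen e0 Te FT (rho + 1).
set d := #|` S|%:R in d0 *.
(* The cap 1 keeps rho + kappa below rho + 1, the bound given to [quadratic_gap]. Of the 4 kappa
   paid by delta / d, one covers the excess of c over rho and three remain. *)
pose kappa := Num.min 1 (delta / d / 4).
have kappa0 : 0 < kappa by rewrite lt_min ltr01 !divr_gt0.
have kappa_delta : d * (4 * kappa) <= delta.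
  rewrite -ler_pdivlMl// mulrC.
  have : kappa <= delta / d / 4 by rewrite ge_min lexx orbT.
  lra.
have Q f : fin_supp f ->
    tsum (fun g => f g * nsum S (fun g s : G => (g * s)%g) f g) <=
      d * (rho - 3 * kappa) * tsum (fun g => f g ^+ 2).
  move=> ff; have n0 : 0 <= tsum (fun g => f g ^+ 2).
    by apply: tsum_ge0 => g; exact: sqr_ge0.
  have c_gt0 : 0 < rho + kappa by rewrite ltr_wpDl.
  have c_le : rho + kappa <= rho + 1 by rewrite lerD2l ge_min lexx.
  have c_rH : (rH < (rho + kappa)%:E)%E by rewrite rhoE lte_fin ltrDl.
  have := gap _ c_gt0 c_le c_rH f ff; rewrite -/d.
  have := ler_wpM2r n0 kappa_delta; lra.
(* Testing [Q] on the indicator of 1 shows this, so rho - 2 kappa is positive, as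
   [spectral_radius_le_quadratic] requires. *)
have rho3 : 0 <= rho - 3 * kappa.
  pose f (g : G) : R := if g == 1%g then 1 else 0.
  have ff : fin_supp f by exact: fin_supp_delta.
  have f0 g : 0 <= f g by rewrite /f; case: ifP.
  have := Q f ff; rewrite (_ : (fun g => f g ^+ 2) = f); last first.
    by apply/funext => g; rewrite /f; case: ifP; rewrite ?expr1n ?expr0n.
  rewrite tsum_delta mulr1 -(pmulr_rge0 _ d0); apply: le_trans.
  by apply: tsum_ge0 => g; rewrite mulr_ge0//; apply: sumr_ge0.
have : (rG <= (rho - 2 * kappa)%:E)%E.
  apply: (spectral_radius_le_quadratic hS) => [s _||f ff f0].
  - exact: rmulK.
  - by lra.
  - apply: le_trans (Q f ff) _; rewrite ler_wpM2r//.
      by apply: tsum_ge0 => g; exact: sqr_ge0.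
    by rewrite ler_pM2l//; lra.
by rewrite rGH rhoE lee_fin; lra.
Qed.
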